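(* Let $A:\mathbb{S}^1\to\mathbb{S}^1$ be the higher Bowen-Series map of the Fuchsian thrice punctured sphere group $\Gamma_0=\langle g,h\rangle$ and let $\nu$ be its measure of maximal entropy. Let $\mu$ be the Patterson-Sullivan measure on $\partial X$ (with respect to the base point $1$ and the generating set $\{g^{\pm1},h^{\pm1},g h^{-1},h g^{-1}\}$), where $X$ is the Cayley graph of $F_2\cong\Gamma_0$ with respect to this generating set, and let $\psi:\partial X\to\mathbb{S}^1$ be the coding map of $A$. Then $\nu=\psi_\ast\mu$.
   Context: Let $r_1$ be complex conjugation and let $r_2,r_3$ be the anti-Möbius reflections in the hyperbolic geodesics of the unit disk $\mathbb{D}$ with endpoints $1,i$ and $i,-1$, respectively. Put $g=r_2\circ r_1$, $h=r_3\circ r_1$, and $\Gamma_0=\langle g,h\rangle$; this is a Fuchsian group, free on $g,h$, and $\mathbb{D}/\Gamma_0$ is a thrice punctured sphere. Label points of $\mathbb{S}^1$ as $v_1=-1$, $v_2=-i$, $v_3=1$, $v_5=g(-1)$, $v_6=i$, $v_7=h(1)$; these occur in this counter-clockwise order. For $a,b\in\mathbb{S}^1$ let $[a,b]$ be the closed counter-clockwise arc from $a$ to $b$. The higher Bowen-Series map $A:\mathbb{S}^1\to\mathbb{S}^1$ is the continuous map equal to $\alpha_k$ on $J_k$, $k=1,\dots,6$, where $J_1=[v_1,v_2],\ \alpha_1=h$; $J_2=[v_2,v_3],\ \alpha_2=g$; $J_3=[v_3,v_5],\ \alpha_3=g^{-1}$; $J_4=[v_5,v_6],\ \alpha_4=h\circ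 g^{-1}$; $J_5=[v_6,v_7],\ \alpha_5=g\circ h^{-1}$; $J_6=[v_7,v_1],\ \alpha_6=h^{-1}$. It is a covering of degree $4$ topologically conjugate to $z\mapsto z^4$ on $\mathbb{S}^1$; its measure of maximal entropy $\nu$ is the unique $A$-invariant Borel probability measure whose entropy equals the topological entropy $\ln 4$ of $A$. Let $\Sigma_M^+$ be the one-sided subshift of sequences $(i_1,i_2,\dots)\in\{1,\dots,6\}^{\mathbb{N}}$ with $A(J_{i_k})\supset J_{i_{k+1}}$ for all $k$, with left shift $\sigma$. Let $X$ be the Cayley graph of $F_2\cong\Gamma_0$ with respect to the generating set $\{g^{\pm1},h^{\pm1},gh^{-1},hg^{-1}\}=\{\alpha_1,\dots,\alpha_6\}$ with word length $|\cdot|$; its Gromov boundary $\partial X$ is identified with $\Sigma_M^+$ by letting $(i_1,i_2,\dots)$ correspond to the endpoint of the geodesic ray from $1$ with successive edge labels $\alpha_{i_1}^{-1},\alpha_{i_2}^{-1},\dots$. The map $\psi:\partial X\cong\Sigma_M^+\to\mathbb{S}^1$ is the continuous surjection with $\psi\circ\sigma=A\circ\psi$ mapping the set of sequences with $i_1=k$ onto $J_k$, $k=1,\dots,6$. The Patterson-Sullivan measure on $\partial X$ (base point $1$, the given generating set) is the weak limit as $n\to\infty$, on the compact space $X\cup\partial X$, of the probability measures $\mu_n=\Big(\sum_{|\gamma|\le n}4^{-|\gamma|}\delta_\gamma\Big)\Big/\Big(\sum_{|\gamma|\le n}4^{-|\gamma|}\Big)$ (where $4$ is the exponential growth rate of the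 number of elements of word length $n$). *)

(* Defs.v *)
From HB Require Import structures.
From mathcomp Require Import all_boot all_order all_algebra.
From mathcomp Require Import complex.
From mathcomp Require Import all_classical all_reals all_analysis.
Set Implicit Arguments.
Unset Strict Implicit.
Unset Printing Implicit Defensive.
Import Order.TTheory GRing.Theory Num.Theory.
Import numFieldNormedType.Exports.
Local Open Scope classical_set_scope.
Local Open Scope ring_scope.

(* A letter [(b, e)] is the generator g if [b = false] and h if [b = true],
   inverted when [e = true]. *)
Definition letter : Type := (bool * bool)%type.

Definition linv (x : letter) : letter := (x.1, ~~ x.2).

Lemma linvK : involutive linv.
Proof. by case=> b e; rewrite /linv /= negbK. Qed.

Lemma linv_neq x : linv x != x.
Proof. by case: x => b []; rewrite xpair_eqE andbC. Qed.

Definition reduced (w : seq letter) := sorted (fun x y => y != linv x) w.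

Record F2 := MkF2 { word : seq letter; wordP : reduced word }.

HB.instance Definition _ := [isSub for word].
HB.instance Definition _ := [Countable of F2 by <:].

Section FreeGroup.

Definition push (x : letter) (w : seq letter) :=
  if w is y :: w' then if y == linv x then w' else x :: w else [:: x].

Lemma push_reduced x w : reduced w -> reduced (push x w).
Proof.
rewrite /reduced; case: w => //= y w pw; case: eqP => [_|/eqP yx] /=.
  exact: path_sorted pw.
by rewrite yx.
Qed.

Lemma pushK x w : reduced w -> push x (push (linv x) w) = w.
Proof.
case: w => [|y w] /=; first by rewrite eqxx.
rewrite linvK; have [-> |yx] := eqVneq y x; last by move=> _ /=; rewrite eqxx.
by case: w => //= z w /andP[/negPf ->].
Qed.

Definition cat_red (u v : seq letter) := foldr push v u.

Lemma cat_red_reduced u v : reduced v -> reduced (cat_red u v).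
Proof. by move=> rv; elim: u => //= x u; apply: push_reduced. Qed.

Lemma cat_red_push x u v : reduced v ->
  cat_red (push x u) v = push x (cat_red u v).
Proof.
move=> rv; case: u => //= y u; case: eqP => [->|//].
by rewrite pushK//; exact: cat_red_reduced.
Qed.

Lemma cat_red0 u : reduced u -> cat_red u [::] = u.
Proof.
elim: u => //= x u IH rxu; rewrite IH; last exact: path_sorted rxu.
by case: u rxu {IH} => //= y u /andP[/negPf ->].
Qed.

Definition word_inv (u : seq letter) := rev (map linv u).

Lemma word_inv_reduced u : reduced u -> reduced (word_inv u).
Proof.
rewrite /reduced /word_inv rev_sorted sorted_map; apply: sub_sorted => x y /=.
by apply: contra => /eqP /(can_inj linvK) ->; rewrite linvK.
Qed.

Lemma cat_red_inv u : cat_red (word_inv u) u = [::].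
Proof.
elim: u => //= x u IH; rewrite /word_inv /= rev_cons /cat_red foldr_rcons /=.
by rewrite linvK eqxx; exact: IH.
Qed.

Lemma word_invK : involutive word_inv.
Proof.
by move=> u; rewrite /word_inv map_rev revK -map_comp map_id_in // => x _ /=;
  rewrite linvK.
Qed.

Definition f2_one : F2 := @MkF2 [::] isT.
Definition f2_mul (u v : F2) : F2 := MkF2 (cat_red_reduced (word u) (wordP v)).
Definition f2_inv (u : F2) : F2 := MkF2 (word_inv_reduced (wordP u)).

Lemma f2_mulA : associative f2_mul.
Proof.
move=> u v w; apply: val_inj => /=; elim: (word u) => //= x s ->.
by rewrite cat_red_push//; exact: wordP.
Qed.

Lemma f2_mul1 : left_id f2_one f2_mul. Proof. by move=> u; apply: val_inj. Qed.

Lemma f2_1mul : right_id f2_one f2_mul.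
Proof. by move=> u; apply: val_inj; exact/cat_red0/wordP. Qed.

Lemma f2_mulV : left_inverse f2_one f2_inv f2_mul.
Proof. by move=> u; apply: val_inj; exact: cat_red_inv. Qed.

Lemma f2_Vmul : right_inverse f2_one f2_inv f2_mul.
Proof.
by move=> u; apply: val_inj; rewrite /= -[X in cat_red X _]word_invK cat_red_inv.
Qed.

End FreeGroup.

HB.instance Definition _ :=
  isGroup.Build F2 f2_mulA f2_mul1 f2_1mul f2_mulV f2_Vmul.

Definition letter_elt (x : letter) : F2 := @MkF2 [:: x] isT.
Definition f2g : F2 := letter_elt (false, false).
Definition f2h : F2 := letter_elt (true, false).

Bind Scope group_scope with F2.
Local Open Scope group_scope.

(* [alpha 0, ..., alpha 5] are the maps alpha_1, ..., alpha_6 of the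
   higher Bowen-Series map, as elements of F_2. *)
Definition alpha (k : 'I_6) : F2 :=
  nth 1 [:: f2h; f2g; f2g^-1; f2h * f2g^-1; f2g * f2h^-1; f2h^-1] k.

Definition word_of_length (n : nat) (u : F2) :=
  [exists t : n.-tuple 'I_6, \prod_(i <- t) alpha i == u].

Lemma word_of_lengthP n u :
  reflect (exists2 s : seq 'I_6, size s = n & \prod_(i <- s) alpha i = u)
          (word_of_length n u).
Proof.
apply: (iffP existsP) => [[t /eqP <-]|[s sn su]].
  by exists t => //; rewrite size_tuple.
by move: sn => /eqP sn; exists (Tuple sn); rewrite su.
Qed.

Lemma prod_letters u : \prod_(x <- word u) letter_elt x = u.
Proof.
apply: val_inj => /=; rewrite -[RHS](cat_red0 (wordP u)).
elim: (word u) => [|x s IH]; first by rewrite big_nil.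
by rewrite big_cons /= IH.
Qed.

Lemma alpha_generate u : exists n, word_of_length n u.
Proof.
suff [s <-] : exists s : seq 'I_6, \prod_(i <- s) alpha i = u.
  by exists (size s); apply/word_of_lengthP; exists s.
rewrite -[u]prod_letters; elim: (word u) => [|x w [s IH]].
  by exists [::]; rewrite !big_nil.
suff [i ix] : exists i, alpha i = letter_elt x.
  by exists (i :: s); rewrite !big_cons ix IH.
case: x => [[] []].
- by exists (@Ordinal 6 5 isT); apply: val_inj.
- by exists (@Ordinal 6 0 isT); apply: val_inj.
- by exists (@Ordinal 6 2 isT); apply: val_inj.
- by exists (@Ordinal 6 1 isT); apply: val_inj.
Qed.

Definition wlen (u : F2) : nat := ex_minn (alpha_generate u).

Lemma wlenP u :
  exists2 s : seq 'I_6, size s = wlen u & \prod_(i <- s) alpha i = u.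
Proof. by rewrite /wlen; case: ex_minnP => n /word_of_lengthP. Qed.

Lemma wlen_le (s : seq 'I_6) : (wlen (\prod_(i <- s) alpha i) <= size s)%N.
Proof.
rewrite /wlen; case: ex_minnP => n _; apply.
by apply/word_of_lengthP; exists s.
Qed.

Definition wdist (u v : F2) : nat := wlen (u^-1 * v).

Definition ball_seq (n : nat) : seq F2 :=
  undup (flatten [seq [seq \prod_(i <- t) alpha i | t : m.-tuple 'I_6]
                 | m <- iota 0 n.+1]).

Lemma mem_ball_seq n u : (u \in ball_seq n) = (wlen u <= n)%N.
Proof.
rewrite mem_undup; apply/flatten_mapP/idP => [[m]|un].
  rewrite mem_iota add0n ltnS => mn /mapP[t _ ->].
  by rewrite (leq_trans (wlen_le _))// size_tuple.
exists (wlen u); first by rewrite mem_iota.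
have [s /eqP su us] := wlenP u.
by apply/mapP; exists (Tuple su); rewrite ?mem_enum.
Qed.

Lemma wlen1 : wlen 1 = 0%N.
Proof.
by have := wlen_le [::]; rewrite big_nil leqn0 => /eqP.
Qed.

Lemma wlenM u v : (wlen (u * v) <= wlen u + wlen v)%N.
Proof.
have [s <- <-] := wlenP u; have [t <- <-] := wlenP v.
by rewrite -big_cat -size_cat wlen_le.
Qed.

Lemma wlenV u : wlen u^-1 = wlen u.
Proof.
suff wlenV_le v : (wlen v^-1 <= wlen v)%N.
  by apply/eqP; rewrite eqn_leq wlenV_le -{1}[u]invgK wlenV_le.
have [s <- <-] := wlenP v.
suff [t <- ->] : exists2 t : seq 'I_6, size t = size s &
  (\prod_(i <- s) alpha i)^-1 = \prod_(i <- t) alpha i by exact: wlen_le.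
elim: s => [|i s [t st IH]]; first by exists [::] => //; rewrite !big_nil invg1.
suff [j ij] : exists j, (alpha i)^-1 = alpha j.
  exists (rcons t j); first by rewrite size_rcons st.
  by rewrite big_cons invgM IH ij -cats1 big_cat /= big_seq1.
exists (nth ord0 [:: inord 5; inord 2; inord 1; inord 4; inord 3; ord0] i).
by apply: val_inj; case: i => [[|[|[|[|[|[|]]]]]] //= ?];
  rewrite /alpha /= ?inordK.
Qed.

Definition is_geodesic_ray (r : nat -> F2) : Prop :=
  r 0 = 1 /\ forall m n, (m <= n)%N -> wdist (r m) (r n) = (n - m)%N.

Definition geodesic_ray : Type := {r : nat -> F2 | `[< is_geodesic_ray r >]}.

HB.instance Definition _ := Choice.on geodesic_ray.

Definition asymptotic (r s : geodesic_ray) : bool :=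
  `[< exists C : nat, forall n, (wdist (val r n) (val s n) <= C)%N >].

Lemma asymptotic_equiv : equiv_class_of asymptotic.
Proof.
split=> [r|r s|s r t].
- by apply/asboolP; exists 0%N => n; rewrite /wdist mulVg wlen1.
- by apply/asboolP/asboolP => -[C rC]; exists C => n;
    rewrite /wdist -wlenV invgM invgK; exact: rC.
- move=> /asboolP[C rC] /asboolP[D rD]; apply/asboolP; exists (C + D)%N => n.
  have -> : wdist (val r n) (val t n) =
    wlen (((val r n)^-1 * val s n) * ((val s n)^-1 * val t n)).
    by rewrite mulgA mulgK.
  by rewrite (leq_trans (wlenM _ _))// leq_add// ?rC ?rD.
Qed.

Canonical asymptotic_rel := EquivRelPack asymptotic_equiv.

(* The exponent sum of g. *)
Definition gdeg (u : F2) : int := (\sum_(x <- word u) (if x.1 then 0 else (-1) ^+ x.2))%R.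

Lemma gdegM u v : gdeg (u * v) = (gdeg u + gdeg v)%R.
Proof.
rewrite /gdeg /=; elim: (word u) => /= [|x s IH]; first by rewrite big_nil add0r.
rewrite big_cons -addrA -IH; case: (cat_red s (word v)) => [|y w] /=.
  by rewrite big_seq1 big_nil addr0.
case: eqP => [->|_]; rewrite !big_cons//.
by case: x => [[] []] /=; rewrite ?add0r ?addrA ?subrr ?addNr ?add0r.
Qed.

Lemma gdeg1 : gdeg 1 = 0%R. Proof. exact: big_nil. Qed.

Lemma gdeg_wlen u : (`|gdeg u| <= (wlen u)%:Z)%R.
Proof.
have [s <- <-] := wlenP u; elim: s => [|i s IH].
  by rewrite big_nil gdeg1 normr0.
rewrite big_cons gdegM /= intS (le_trans (ler_normD _ _))// lerD//.
by case: i => [[|[|[|[|[|[|]]]]]] //= ?]; rewrite /gdeg /= !big_cons big_nil.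
Qed.

Lemma gdegX n : gdeg (f2g ^+ n) = n.
Proof.
by elim: n => [|n IH]; rewrite ?gdeg1// expgS gdegM IH {1}/gdeg /= big_seq1 intS.
Qed.

Lemma wlen_gX n : wlen (f2g ^+ n) = n.
Proof.
apply/eqP; rewrite eqn_leq; apply/andP; split; last first.
  by have := gdeg_wlen (f2g ^+ n); rewrite gdegX lez_nat.
have := wlen_le (nseq n (@Ordinal 6 1 isT)); rewrite size_nseq big_nseq.
by rewrite -Monoid.iteropE.
Qed.

Lemma gX_geodesic : is_geodesic_ray (fun n => f2g ^+ n).
Proof.
split=> // m n mn; rewrite /wdist -{1}(subnKC mn) expgnDr mulKg.
exact: wlen_gX.
Qed.

Definition boundary : Type := {eq_quot asymptotic}%qT.
HB.instance Definition _ := Choice.on boundary.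

Definition boundary_pt (r : geodesic_ray) : boundary := (\pi r)%qT.

Definition gX_ray : geodesic_ray :=
  exist (fun r => `[< is_geodesic_ray r >]) _ (asboolT gX_geodesic).

HB.instance Definition _ := isPointed.Build boundary (boundary_pt gX_ray).

Local Close Scope group_scope.

Definition gromov_product (u v : F2) : rat :=
  ((wlen u)%:R + (wlen v)%:R - (wdist u v)%:R) / 2%:R.

(* The Cayley graph enters through its vertices: the compactification is the
   closed subspace F_2 u dX of X u dX. *)
Definition bordification : Type := (F2 + boundary)%type.

(* Since Gromov products are half-integers, "eventually at least N" says that
   the inferior limit is at least N. *)
Definition shadow (xi : boundary) (N : nat) : set bordification :=
  [set p | exists2 r, boundary_pt r = xi &
    match p with
    | inl u => \forall n \near \oo, N%:R <= gromov_product (val r n) u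
    | inr eta => exists2 s, boundary_pt s = eta &
        \forall n \near \oo, N%:R <= gromov_product (val r n) (val s n)
    end].

(* The points of F_2 are isolated and the shadows are the basic
   neighbourhoods of the points of dX. *)
Definition bordification_open : set (set bordification) :=
  [set U | forall xi, U (inr xi) -> exists N, shadow xi N `<=` U].

Lemma shadow_le xi M N : (M <= N)%N -> shadow xi N `<=` shadow xi M.
Proof.
move=> MN p [r rxi rp]; exists r => //; case: p rp => [u|eta] /=.
  by apply: filterS => n; apply: le_trans; rewrite ler_nat.
move=> [s seta rs]; exists s => //.
by apply: filterS rs => n; apply: le_trans; rewrite ler_nat.
Qed.

Lemma bordification_openT : bordification_open setT.
Proof. by move=> xi _; exists 0%N. Qed.

Lemma bordification_openI : setI_closed bordification_open.
Proof.
move=> U V oU oV xi [/oU[M MU] /oV[N NV]]; exists (maxn M N) => p pMN.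
by split; [apply/MU|apply/NV]; apply: shadow_le pMN;
  rewrite ?leq_maxl ?leq_maxr.
Qed.

Lemma bordification_open_bigU (I : Type) (f : I -> set bordification) :
  (forall i, bordification_open (f i)) -> bordification_open (\bigcup_i f i).
Proof.
move=> of_ xi [i _ /of_[N Nf]]; exists N => p /Nf; by exists i.
Qed.

HB.instance Definition _ := Choice.on bordification.
HB.instance Definition _ := isPointed.Build bordification (inl 1%g).
HB.instance Definition _ := isOpenTopological.Build bordification
  bordification_openT bordification_openI bordification_open_bigU.
HB.instance Definition _ := Topological.copy boundary
  (@initial_topology boundary bordification inr).

Notation borel T := (g_sigma_algebraType (@open T)).

Definition weak_cvg (R : realType) (T : ptopologicalType)
    (m : nat -> set (borel T) -> \bar R) (m0 : set (borel T) -> \bar R) : Prop :=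
  forall f : T -> R, continuous f -> (exists M : R, forall x, `|f x| <= M) ->
    (fun n => \int[m n]_x (f x)%:E)%E @ \oo --> (\int[m0]_x (f x)%:E)%E.

Definition ball_measure (R : realType) (n : nat) :
    {measure set (borel bordification) -> \bar R} :=
  msum (fun k => let u := nth 1%g (ball_seq n) k in
                 mscale ((4^-1 : R) ^+ wlen u)%:nng
                   (@dirac _ (borel bordification) (inl u) R))
       (size (ball_seq n)).

Definition ball_mass (R : realType) (n : nat) : R :=
  \sum_(u <- ball_seq n) 4^-1 ^+ wlen u.

Lemma ball_mass_inv_ge0 (R : realType) n : 0 <= (ball_mass R n)^-1.
Proof.
by rewrite invr_ge0; apply: sumr_ge0 => u _; rewrite exprn_ge0// invr_ge0.
Qed.

Definition ps_approx (R : realType) (n : nat) :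
    {measure set (borel bordification) -> \bar R} :=
  mscale (NngNum (ball_mass_inv_ge0 R n)) (ball_measure R n).

Definition is_patterson_sullivan (R : realType)
    (mu : probability (borel boundary) R) : Prop :=
  weak_cvg (fun n => ps_approx R n : set _ -> \bar R)
    (pushforward mu (inr : borel boundary -> borel bordification)).

Section Circle.
Variable R : realType.
Notation C := R[i].

(* [R[i]^o] is the copy of the complex plane carrying its norm topology. *)
Definition circle : Type := set_type [set z : C^o | `|z| = 1].

HB.instance Definition _ := Topological.on circle.

Definition to_circle (z : C) (z1 : `|z| = 1) : circle := exist _ z (mem_set z1).

Lemma circle_norm (z : circle) : `|val z : C| = 1.
Proof. by case: z => z /= /set_mem. Qed.

(* The geodesic of the unit disk with endpoints p, q (p + q != 0) lies on the
   circle through p and q orthogonal to the unit circle: it has center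
   c = 2pq/(p+q) and squared radius |c|^2 - 1. *)
Definition geodesic_center (p q : C) : C := 2 * p * q / (p + q).

Definition geodesic_reflection (p q z : C) : C :=
  let c := geodesic_center p q in c + (`|c| ^+ 2 - 1) / (z - c)^*.

Lemma conj_circle (z : C) : `|z| = 1 -> `|z^*| = 1.
Proof. by rewrite norm_conjC. Qed.

Lemma geodesic_reflection_circle (p q z : C) :
  `|z| = 1 -> `|geodesic_reflection p q z| = 1.
Proof.
rewrite /geodesic_reflection; move: (geodesic_center p q) => c.
have [-> c1|zc z1] := eqVneq z c; first by rewrite subrr conjC0 invr0 mulr0 addr0.
have zz : z * z^* = 1 by rewrite -normCK z1 expr1n.
have w0 : (z - c)^* != 0 by rewrite conjC_eq0 subr_eq0.
rewrite -[X in X + _](mulfK w0) -mulrDl normrM normfV norm_conjC normCK.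
have -> : c * (z - c)^* + (c * c^* - 1) = (c - z) * z^*.
  by rewrite rmorphB mulrBr addrA subrK mulrBl zz.
by rewrite normrM norm_conjC z1 mulr1 distrC divff// normr_eq0 subr_eq0.
Qed.

Definition circle_map (f : C -> C) (f1 : forall z, `|z| = 1 -> `|f z| = 1)
  (z : circle) : circle := to_circle (f1 _ (circle_norm z)).

Lemma norm_i : `|'i%C : C| = 1.
Proof. by rewrite normc_def /= expr0n expr1n add0r sqrtr1. Qed.

Lemma norm_Ni : `|- 'i%C : C| = 1. Proof. by rewrite normrN norm_i. Qed.

Definition pt_1 : circle := to_circle (normr1 C).
Definition pt_N1 : circle := to_circle (normrN1 C).
Definition pt_i : circle := to_circle norm_i.
Definition pt_Ni : circle := to_circle norm_Ni.

HB.instance Definition _ := isPointed.Build circle pt_1.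

Definition refl1 : circle -> circle := circle_map conj_circle.
Definition refl2 : circle -> circle :=
  circle_map (@geodesic_reflection_circle 1 'i%C).
Definition refl3 : circle -> circle :=
  circle_map (@geodesic_reflection_circle 'i%C (-1)).

Definition act_letter (x : letter) : circle -> circle :=
  match x with
  | (false, false) => refl2 \o refl1
  | (false, true) => refl1 \o refl2
  | (true, false) => refl3 \o refl1
  | (true, true) => refl1 \o refl3
  end.

(* The action on the unit circle given by the isomorphism from F_2 to the
   thrice punctured sphere group. *)
Definition act (u : F2) (z : circle) : circle := foldr act_letter z (word u).

Lemma refl1K : involutive refl1.
Proof. by move=> z; apply: val_inj => /=; rewrite conjCK. Qed.

Lemma geodesic_reflectionK (p q z : C) :
  `|z| = 1 -> `|geodesic_center p q| != 1 ->
  geodesic_reflection p q (geodesic_reflection p q z) = z.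
Proof.
rewrite /geodesic_reflection; move: (geodesic_center p q) => c z1 c1.
have zc : z - c != 0.
  by rewrite subr_eq0; apply: contraNneq c1 => <-; rewrite z1.
have k0 : `|c| ^+ 2 - 1 != 0.
  by rewrite subr_eq0 sqrp_eq1.
rewrite [X in X^*]addrAC subrr add0r rmorphM fmorphV /= conjCK.
rewrite (CrealP _); last by apply: rpredB; [exact/rpredX/normr_real|exact: rpred1].
by rewrite invf_div mulrCA divff// mulr1 subrKC.
Qed.

Lemma geodesic_center_neq1 (p q : C) : `|p| = 1 -> `|q| = 1 ->
  `|p + q| != 2 -> `|geodesic_center p q| != 1.
Proof.
move=> p1 q1 pq; rewrite !normrM normfV p1 q1 !mulr1 normr_nat.
have [->|n0] := eqVneq `|p + q| 0; first by rewrite invr0 mulr0 eq_sym oner_neq0.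
by apply: contra pq => /eqP /(canRL (mulfVK n0)); rewrite mul1r => ->.
Qed.

Lemma norm_pm1_i (p : C) : p = 1 \/ p = -1 -> `|p + 'i%C| != 2.
Proof.
move=> p1; apply/eqP => /(congr1 (fun x : C => x ^+ 2)).
have -> : `|p + 'i%C| ^+ 2 = 2.
  rewrite normc_def -rmorphXn sqr_sqrtr ?addr_ge0 ?sqr_ge0//.
  by case: p1 => -> /=; rewrite ?oppr0 ?add0r ?addr0 ?sqrrN ?expr1n rmorphD.
by move=> /eqP; rewrite -natrX eqr_nat.
Qed.

Lemma refl2K : involutive refl2.
Proof.
move=> z; apply: val_inj => /=; apply: geodesic_reflectionK.
  exact: circle_norm.
apply: geodesic_center_neq1; rewrite ?normr1 ?norm_i//.
by apply: norm_pm1_i; left.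
Qed.

Lemma refl3K : involutive refl3.
Proof.
move=> z; apply: val_inj => /=; apply: geodesic_reflectionK.
  exact: circle_norm.
apply: geodesic_center_neq1; rewrite ?normrN1 ?norm_i//.
by rewrite addrC; apply: norm_pm1_i; right.
Qed.

Lemma act_letterK x z : act_letter x (act_letter (linv x) z) = z.
Proof. by case: x => [[] []] /=; rewrite ?(refl1K, refl2K, refl3K). Qed.

Lemma act1 z : act 1%g z = z. Proof. by []. Qed.

Lemma actM u v z : act (u * v)%g z = act u (act v z).
Proof.
rewrite /act /=; elim: (word u) => //= x s <-.
case: (cat_red s (word v)) => //= y w.
by case: eqP => [->|_] //=; rewrite act_letterK.
Qed.

(* The closed counter-clockwise arc from a to b. *)
Definition ccw_arc (a b : circle) : set circle :=
  [set z | exists t s : R, [/\ 0 <= t, t <= s & s < 2 * pi] /\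
    (val z : C) = val a * (cos t +i* sin t)%C /\
    (val b : C) = val a * (cos s +i* sin s)%C].

Definition bs_vertex (k : 'I_6) : circle :=
  nth pt_N1 [:: pt_N1; pt_Ni; pt_1; act f2g pt_N1; pt_i; act f2h pt_1] k.

(* [bs_arc 0, ..., bs_arc 5] are the arcs J_1, ..., J_6; [ordS] is the cyclic
   successor. *)
Definition bs_arc (k : 'I_6) : set circle := ccw_arc (bs_vertex k) (bs_vertex (ordS k)).

Definition is_higher_bowen_series (A : circle -> circle) : Prop :=
  continuous A /\ forall k z, bs_arc k z -> A z = act (alpha k) z.

Definition subshift (A : circle -> circle) : set (nat -> 'I_6) :=
  [set i | forall k, bs_arc (i k.+1) `<=` A @` bs_arc (i k)].

Definition seq_shift (i : nat -> 'I_6) : nat -> 'I_6 := fun k => i k.+1.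

(* The identification of the boundary with the subshift: [i] corresponds to
   [xi] when xi is the endpoint of the geodesic ray from 1 whose successive
   edge labels are the inverses of the [alpha (i k)]. *)
Definition codes (i : nat -> 'I_6) (xi : boundary) : Prop :=
  exists2 r : geodesic_ray, boundary_pt r = xi &
    forall n, val r n = (\prod_(k < n) (alpha (i k))^-1)%g.

Definition is_coding_map (A : circle -> circle) (psi : boundary -> circle) :
    Prop :=
  [/\ continuous psi,
      range psi = setT,
      forall i xi eta, subshift A i -> codes i xi -> codes (seq_shift i) eta ->
        psi eta = A (psi xi) &
      forall k, psi @` [set xi | exists i, [/\ subshift A i, i 0%N = k
                                              & codes i xi]] = bs_arc k].

End Circle.

Section Entropy.
Variable R : realType.

(* The member of the common refinement of C, f^-1 C, ..., f^-(n-1) C with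
   indices w. *)
Definition refinement (T : Type) (f : T -> T) (I : finType) (C : I -> set T)
    (n : nat) (w : {ffun 'I_n -> I}) : set T :=
  [set x | forall k : 'I_n, C (w k) (iter k f x)].

Definition measurable_partition d (T : measurableType d) (I : finType)
    (C : I -> set T) : Prop :=
  [/\ forall j, measurable (C j), trivIset setT C & \bigcup_j C j = setT].

Definition open_cover (T : topologicalType) (I : finType) (C : I -> set T) :
    Prop :=
  (forall j, open (C j)) /\ \bigcup_j C j = setT.

Section MeasureEntropy.
Context d (T : measurableType d).
Implicit Types (P : set T -> \bar R) (f : T -> T).

(* [ln 0 = 0], so that null sets contribute 0. *)
Definition shannon_entropy P (I : finType) (C : I -> set T) : R :=
  - \sum_(j : I) fine (P (C j)) * ln (fine (P (C j))).

(* The limit superior is a limit when f preserves P. *)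
Definition partition_entropy P f (I : finType) (C : I -> set T) : \bar R :=
  limn_esup (fun n => (shannon_entropy P (@refinement T f I C n) / n%:R)%:E).

Definition measure_entropy P f : \bar R :=
  ereal_sup [set e | exists (k : nat) (C : 'I_k -> set T),
    measurable_partition C /\ e = partition_entropy P f C].

Definition preserves P f : Prop :=
  forall B, measurable B -> P (f @^-1` B) = P B.

End MeasureEntropy.

Section TopologicalEntropy.
Variable T : topologicalType.
Implicit Type f : T -> T.

Definition covering (I : finType) (C : I -> set T) (S : {set I}) : bool :=
  `[< \bigcup_(j in [set` S]) C j = setT >].

(* [#|I|] is the largest value in the minimum, reached at the full set. *)
Definition cover_number (I : finType) (C : I -> set T) : nat :=
  \big[minn/#|I|]_(S : {set I} | covering C S) #|S|.

Definition cover_entropy f (I : finType) (C : I -> set T) : \bar R :=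
  limn_esup (fun n =>
    (ln (cover_number (@refinement T f I C n))%:R / n%:R)%:E).

(* Topological entropy by open covers; finite covers suffice on a compact
   space. *)
Definition topological_entropy f : \bar R :=
  ereal_sup [set e | exists (k : nat) (C : 'I_k -> set T),
    open_cover C /\ e = cover_entropy f C].

End TopologicalEntropy.

Definition is_maximal_entropy (T : ptopologicalType) (f : T -> T)
    (P : probability (borel T) R) : Prop :=
  @preserves _ (borel T) P f /\
  @measure_entropy _ (borel T) P f = topological_entropy f.

End Entropy.

(* Main.v *)
(* The circle is coded by twelve symbols: the open arcs J_k and the vertices.
   Each symbol has exactly four predecessors, and by continuity of psi long
   itineraries locate a point in any prescribed neighbourhood of it.
   Suppose that nu charges two words a t w and a' t w differently, for two
   predecessors a, a' of t. Coding orbits backwards with the transition weights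
   1/4, perturbed to (1 +- x)/4 on these two words, then bounds the entropy of
   every finite partition by some c < ln 4, by Gibbs' inequality. But A is
   injective on the members of an open cover and points have 4^n preimages, so
   the topological entropy is at least ln 4. Hence nu(t w) = 4 nu(a t w); this
   makes the vertices nu-null and gives the words of n arcs mass 4^(1-n)/6.
   In the free group, the ball mass of the elements whose geodesic from 1 begins
   with a given word only depends on the length of that word, so the
   Patterson-Sullivan measure gives cylinders of length n the mass 4^(1-n)/6.
   A point lies in the psi-images of at most 2^n of these cylinders, so it is
   null for psi_* mu, which therefore agrees with nu on all itineraries. *)
Require Import Defs.
From HB Require Import structures.
From mathcomp Require Import all_boot all_order all_algebra.
From mathcomp Require Import complex zify ring lra.
From mathcomp Require Import all_classical all_reals all_analysis.
From mathcomp Require Import measurable_realfun.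
Set Implicit Arguments.
Unset Strict Implicit.
Unset Printing Implicit Defensive.
Import Order.TTheory GRing.Theory Num.Theory.
Import numFieldNormedType.Exports.
Local Open Scope classical_set_scope.
Local Open Scope ring_scope.

(** Coding runs backwards because of the vertices: forwards, an arc has seven successors (four arcs
    and three vertices) and a vertex only one, whereas all twelve symbols have four predecessors.
    Treating vertices as symbols makes the itinerary an honest function on the circle, so nothing is
    discarded before the vertices are known to be null. The perturbation pays off because its gain
    is of first order in x and its loss of second order. The obstacle is that entropy is a supremum
    over all finite partitions, whose atoms need not be unions of itinerary sets. The atom is
    therefore guessed from finitely many symbols and encoded together with the symbol; the cost of
    right and wrong guesses is tuned to use at most half of the gain. As psi is not injective, the
    preimage of a word of arcs is merely contained in a cylinder. This gives only an inequality on
    words, but both measures have total mass 1, so passing to complements turns it into an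
    equality. *)

(** * Finite-valued measurable maps under a probability *)

Section RealProbability.
Context d (T : measurableType d) (R : realType) (P : probability T R).

Definition prob (A : set T) : R := fine (P A).

Lemma probE A : measurable A -> P A = (prob A)%:E.
Proof. by move=> mA; rewrite fineK// fin_num_measure. Qed.

Lemma prob_ge0 A : 0 <= prob A.
Proof. exact/fine_ge0/measure_ge0. Qed.

Lemma prob_le A B : measurable A -> measurable B -> A `<=` B -> prob A <= prob B.
Proof.
by move=> mA mB AB; rewrite -lee_fin -!probE//; apply: le_measure; rewrite ?inE.
Qed.

Lemma probT : prob setT = 1.
Proof. by rewrite /prob probability_setT. Qed.

Lemma prob0 : prob set0 = 0.
Proof. by rewrite /prob measure0. Qed.

Lemma prob_setU_le A B : measurable A -> measurable B ->
  prob (A `|` B) <= prob A + prob B.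
Proof.
move=> mA mB; rewrite -lee_fin EFinD -!probE//; last exact: measurableU.
exact: measureU2.
Qed.

Lemma prob_setC A : measurable A -> prob (~` A) = 1 - prob A.
Proof. by move=> mA; rewrite /prob probability_setC// fineB ?fin_num_measure. Qed.

Lemma prob_setD A B : measurable A -> measurable B -> A `<=` B ->
  prob (B `\` A) = prob B - prob A.
Proof.
move=> mA mB AB; apply/eqP; rewrite eq_sym subr_eq; apply/eqP.
rewrite -fineD ?fin_num_measure//; last exact: measurableD.
rewrite -measureU//; [|exact: measurableD|by rewrite setDKI].
by rewrite /prob setDKU.
Qed.

Lemma prob_bigsetU_le (I : finType) (A : I -> set T) :
  (forall i, measurable (A i)) ->
  prob (\big[setU/set0]_i A i) <= \sum_i prob (A i).
Proof.
move=> mA; suff : measurable (\big[setU/set0]_i A i) /\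
  prob (\big[setU/set0]_i A i) <= \sum_i prob (A i) by case.
elim/big_rec2: _ => [|i r U _ [mU Ur]]; first by rewrite prob0.
split; first exact: measurableU.
by apply: le_trans (prob_setU_le _ _) _; rewrite ?lerD2l.
Qed.

Definition finitely_measurable (I : finType) (phi : T -> I) :=
  forall i, measurable (phi @^-1` [set i]).

Lemma finitely_measurable_preimage (I : finType) (phi : T -> I) (S : set I) :
  finitely_measurable phi -> measurable (phi @^-1` S).
Proof.
move=> mphi; have -> : phi @^-1` S = \bigcup_(i in S) (phi @^-1` [set i]).
  by apply/seteqP; split=> [x Sx|x [i Si /= ->]//]; exists (phi x).
by apply: fin_bigcup_measurable => //; exact: finite_finset.
Qed.

Lemma finitely_measurable_pair (I J : finType) (phi : T -> I) (chi : T -> J) :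
  finitely_measurable phi -> finitely_measurable chi ->
  finitely_measurable (fun x => (phi x, chi x)).
Proof.
move=> mphi mchi [i j].
have -> : (fun x => (phi x, chi x)) @^-1` [set (i, j)] =
    phi @^-1` [set i] `&` chi @^-1` [set j].
  by apply/seteqP; split=> [x [<- <-]//|x /= [-> ->]].
exact: measurableI.
Qed.

Lemma prob_partition (I : finType) (phi : T -> I) B :
  finitely_measurable phi -> measurable B ->
  \sum_i prob (B `&` phi @^-1` [set i]) = prob B.
Proof.
move=> mphi mB; apply/esym; rewrite {1}/prob.
have BE : B = \bigcup_(i in [set: I]) (B `&` phi @^-1` [set i]).
  by apply/seteqP; split=> [x Bx|x [i _ []]//]; exists (phi x).
have fI : finite_set [set: I] by exact: finite_finset.
have tB : trivIset [set: I] (fun i => B `&` phi @^-1` [set i]).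
  by move=> i j _ _ [x [[_ /= xi] [_ /= xj]]]; rewrite -xi.
rewrite [in LHS]BE measure_fin_bigcup//; last by move=> i _; exact: measurableI.
have -> : [set: I] = [set` index_enum I].
  by apply/seteqP; split=> // i _ /=; rewrite mem_index_enum.
rewrite -fsbig_seq ?index_enum_uniq//.
rewrite (eq_bigr (fun i => (prob (B `&` phi @^-1` [set i]))%:E)) ?sumEFin//.
by move=> i _; rewrite -probE//; exact: measurableI.
Qed.

End RealProbability.

(** * Geometry of the arcs *)

Section CircleCoordinates.
Variable R : realType.
Implicit Types (z : circle R) (p : R).

Definition xco z : R := complex.Re (val z : R[i]).
Definition yco z : R := complex.Im (val z : R[i]).

Lemma circleE z : xco z ^+ 2 + yco z ^+ 2 = 1.
Proof.
apply: (@complexI R); rewrite add_Re2_Im2; have := circle_norm z => -> .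
by rewrite expr1n.
Qed.

Lemma circleP z w : xco z = xco w -> yco z = yco w -> z = w.
Proof.
move=> xx yy; apply: val_inj; apply/eqP.
by rewrite eq_complex; apply/andP; split; apply/eqP.
Qed.

Lemma refl1E z : xco (refl1 z) = xco z /\ yco (refl1 z) = - yco z.
Proof. by rewrite /xco /yco /=; case: (val z : R[i]). Qed.

(** Both geodesics lie on circles of center [p + i], with [p = 1] or [p = -1], hence of radius 1. On
    the unit circle [d] is the squared distance from [z] to that center, so the reflection is
    [c + (z - c) / d]. *)
Lemma reflection_coordinates p (z : R[i]) : p ^+ 2 = 1 ->
    complex.Re z ^+ 2 + complex.Im z ^+ 2 = 1 ->
  let c : R[i] := (p +i* 1)%C in
  let d := 3 - 2 * p * complex.Re z - 2 * complex.Im z in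
  0 < d /\ c + (`|c| ^+ 2 - 1) / (z - c)^* =
  ((p + (complex.Re z - p) / d) +i* (1 + (complex.Im z - 1) / d))%C.
Proof.
move=> p2; case: z => x y xy c; rewrite [complex.Re _]/= [complex.Im _]/= in xy * => d.
have d0 : 0 < d.
  have : (p * x) ^+ 2 + y ^+ 2 = 1 by rewrite exprMn p2 mul1r.
  rewrite /d -mulrA; move: (p * x) => u uy.
  (* If [d] were not positive, [u + y] would be at least 3/2, but its square is at most 2 on the
     circle. *)
  have := sqr_ge0 (u - y); rewrite ltNge; apply: contraPN => h.
  by apply/negP; rewrite -ltNge; nra.
split; first exact: d0.
have -> : `|c| ^+ 2 - 1 = 1 :> R[i].
  rewrite -add_Re2_Im2 /= p2 expr1n; apply/eqP.
  by rewrite eq_complex /= oppr0 addr0 addrK !eqxx.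
rewrite mul1r; set w := (X in X^-1).
have wE : w = ((x - p) -i* (y - 1))%C by [].
have w2 : (x - p) ^+ 2 + (y - 1) ^+ 2 = d.
  by rewrite /d; nra.
suff -> : w^-1 = ((x - p) / d +i* ((y - 1) / d))%C by [].
rewrite wE; apply/eqP; rewrite eq_complex /= sqrrN w2 -mulNr opprK.
by rewrite !eqxx.
Qed.

Lemma geodesic_center1i : geodesic_center 1 'i%C = (1 +i* 1)%C :> R[i].
Proof.
rewrite /geodesic_center.
have n0 : (1 + 'i%C : R[i]) != 0.
  by rewrite eq_complex /= addr0 oner_eq0.
apply: (mulIf n0); rewrite mulfVK//; apply/eqP; rewrite eq_complex /=.
by apply/andP; split; apply/eqP; ring.
Qed.

Lemma geodesic_centeriN1 : geodesic_center 'i%C (-1) = (-1 +i* 1)%C :> R[i].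
Proof.
rewrite /geodesic_center.
have n0 : ('i%C - 1 : R[i]) != 0.
  by rewrite eq_complex /= add0r oppr_eq0 oner_eq0.
apply: (mulIf n0); rewrite mulfVK//; apply/eqP; rewrite eq_complex /=.
by apply/andP; split; apply/eqP; ring.
Qed.

Definition reflE p (r : circle R -> circle R) := forall z,
  let d := 3 - 2 * p * xco z - 2 * yco z in
  [/\ 0 < d, xco (r z) = p + (xco z - p) / d & yco (r z) = 1 + (yco z - 1) / d].

Lemma refl2E : reflE 1 (@refl2 R).
Proof.
move=> z d; have [d0] := reflection_coordinates (expr1n _ 2) (circleE z).
by rewrite -geodesic_center1i => e; split=> //; rewrite /xco /yco /= /geodesic_reflection e.
Qed.

Lemma refl3E : reflE (-1) (@refl3 R).
Proof.
move=> z d; have p1 : (-1 : R) ^+ 2 = 1 by rewrite sqrrN expr1n.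
have [d0] := reflection_coordinates p1 (circleE z).
by rewrite -geodesic_centeriN1 => e; split=> //; rewrite /xco /yco /= /geodesic_reflection e.
Qed.

(* [lin a b c z = 0] is the chord cut out by a geodesic of the Klein model. *)
Definition lin (a b c : R) z : R := a * xco z + b * yco z - c.

Lemma lin_refl1 a b c z : lin a b c (refl1 z) = lin a (- b) c z.
Proof. by rewrite /lin; have [-> ->] := refl1E z; ring. Qed.

Lemma lin_refl p r a b c z : p ^+ 2 = 1 -> reflE p r ->
  exists2 d, 0 < d & lin a b c (r z) =
    d * lin (- a - 2 * p * b + 2 * p * c) (- 2 * p * a - b + 2 * c)
            (3 * c - 2 * p * a - 2 * b) z.
Proof.
move=> p2 /(_ z) [d0 xr yr]; exists (3 - 2 * p * xco z - 2 * yco z)^-1.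
  by rewrite invr_gt0.
rewrite /lin xr yr; move: d0; move: (xco z) (yco z) => x y d0.
apply: (mulfI (lt0r_neq0 d0)); rewrite mulrA divff ?gt_eqF// mul1r.
have -> : (3 - 2 * p * x - 2 * y) * (a * (p + (x - p) / (3 - 2 * p * x - 2 * y)) +
   b * (1 + (y - 1) / (3 - 2 * p * x - 2 * y)) - c) =
   a * p * (3 - 2 * p * x - 2 * y) + a * (x - p) + b * (3 - 2 * p * x - 2 * y)
    + b * (y - 1) - c * (3 - 2 * p * x - 2 * y).
  by field; rewrite gt_eqF.
have : p * p * a * x = a * x by rewrite -expr2 p2 mul1r.
by move=> h; ring: h.
Qed.

End CircleCoordinates.

Notation O6 n := (@Ordinal 6 n isT).

Lemma ord6_ind (P : 'I_6 -> Prop) :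
  P (O6 0) -> P (O6 1) -> P (O6 2) -> P (O6 3) -> P (O6 4) -> P (O6 5) ->
  forall k, P k.
Proof.
move=> P0 P1 P2 P3 P4 P5 [[|[|[|[|[|[|k]]]]]] k6] //;
  by rewrite (bool_irrelevance k6 isT).
Qed.

(* [inl k] stands for the interior of the arc J_(k+1), [inr k] for its
   initial vertex. *)
Notation symbol := ('I_6 + 'I_6)%type.

(* Index (from 0) of the image of the vertex with index [k]. *)
Definition vimage (k : 'I_6) : 'I_6 :=
  nth ord0 [:: O6 0; O6 4; O6 2; O6 0; O6 4; O6 2] k.

Definition succ (i j : 'I_6) : bool :=
  (j : nat) \in nth [::] [:: [:: 0; 1; 2; 3]; [:: 4; 5; 0; 1]; [:: 2; 3; 4; 5];
    [:: 0; 1; 2; 3]; [:: 4; 5; 0; 1]; [:: 2; 3; 4; 5]]%N i.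

(** The image of an arc consists of four consecutive arcs. The table for [inr j] lists the three
    vertices strictly inside it; its two ends are images of vertices. *)
Definition adm (s t : symbol) : bool :=
  match s, t with
  | inl i, inl j => succ i j
  | inl i, inr j => (j : nat) \in nth [::] [:: [:: 1; 2; 3]; [:: 5; 0; 1];
      [:: 3; 4; 5]; [:: 1; 2; 3]; [:: 5; 0; 1]; [:: 3; 4; 5]]%N i
  | inr i, inr j => j == vimage i
  | inr _, inl _ => false
  end.

(** * Affine forms detecting the arcs and their images *)

Section CircleSymbols.
Variable R : realType.
Implicit Types (z : circle R).

Lemma xyco_bound z : (-1 <= xco z <= 1) /\ (-1 <= yco z <= 1).
Proof. by have := circleE z; split; apply/andP; split; nra. Qed.

Lemma ordS6 : (ordS (O6 0) = O6 1) * (ordS (O6 1) = O6 2) * (ordS (O6 2) = O6 3) *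
  (ordS (O6 3) = O6 4) * (ordS (O6 4) = O6 5) * (ordS (O6 5) = O6 0).
Proof. by do ![split]; apply: val_inj. Qed.

Lemma bs_vertexE (k : 'I_6) :
  xco (bs_vertex R k) = nth 0 [:: -1; 0; 1; 3/5; 0; -(3/5)] k /\
  yco (bs_vertex R k) = nth 0 [:: 0; -1; 0; 4/5; 1; 4/5] k.
Proof.
have c0 : xco (pt_N1 R) = -1 /\ yco (pt_N1 R) = 0 by rewrite /xco /yco /= oppr0.
have c1 : xco (pt_1 R) = 1 /\ yco (pt_1 R) = 0 by [].
elim/ord6_ind: k; try by rewrite /xco /yco /= ?oppr0.
- have -> : bs_vertex R (O6 3) = refl2 (refl1 (pt_N1 R)) by [].
  have [d0 -> ->] := refl2E (refl1 (pt_N1 R)); have [-> ->] := refl1E (pt_N1 R).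
  by rewrite c0.1 c0.2 /=; split; field; rewrite -?mulNrn ?pnatr_eq0//; lra.
- have -> : bs_vertex R (O6 5) = refl3 (refl1 (pt_1 R)) by [].
  have [d0 -> ->] := refl3E (refl1 (pt_1 R)); have [-> ->] := refl1E (pt_1 R).
  by rewrite c1.1 c1.2 /=; split; field; rewrite -?mulNrn ?pnatr_eq0//; lra.
Qed.

(** The chord of the arc: the form vanishes at the two ends and is positive between them.
    [image_form] does the same for the image of the arc. *)
Definition arc_form (k : 'I_6) z : R :=
  nth 0 [:: lin (-1) (-1) 1 z; lin 1 (-1) 1 z; lin 2 1 2 z; lin 1 3 3 z;
            lin (-1) 3 3 z; lin (-2) 1 2 z] k.

Definition image_form (k : 'I_6) z : R :=
  nth 0 [:: lin 1 (-1) (-1) z; lin (-1) (-1) (-1) z; lin 0 1 0 z;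
            lin 1 (-1) (-1) z; lin (-1) (-1) (-1) z; lin 0 1 0 z] k.

Definition sym z : symbol :=
  let x := xco z in let y := yco z in
  if y < 0 then
    if x < 0 then inl (O6 0) else if x == 0 then inr (O6 1) else inl (O6 1)
  else if y == 0 then if x < 0 then inr (O6 0) else inr (O6 2)
  else if x < -(3/5) then inl (O6 5) else if x == -(3/5) then inr (O6 5)
  else if x < 0 then inl (O6 4) else if x == 0 then inr (O6 4)
  else if x < 3/5 then inl (O6 3) else if x == 3/5 then inr (O6 3)
  else inl (O6 2).

Variant sym_spec z : symbol -> Prop :=
| SymA0 of xco z < 0 & yco z < 0 : sym_spec z (inl (O6 0))
| Sym1 of 0 < xco z & yco z < 0 : sym_spec z (inl (O6 1))
| Sym2 of 3/5 < xco z & 0 < yco z : sym_spec z (inl (O6 2))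
| Sym3 of 0 < xco z & xco z < 3/5 & 4/5 < yco z : sym_spec z (inl (O6 3))
| Sym4 of -(3/5) < xco z & xco z < 0 & 4/5 < yco z : sym_spec z (inl (O6 4))
| Sym5 of xco z < -(3/5) & 0 < yco z : sym_spec z (inl (O6 5))
| SymVertex k of z = bs_vertex R k : sym_spec z (inr k).

Lemma sym_ofP z : sym_spec z (sym z).
Proof.
have V (k : 'I_6) : xco z = nth 0 [:: -1; 0; 1; 3/5; 0; -(3/5)] k ->
    yco z = nth 0 [:: 0; -1; 0; 4/5; 1; 4/5] k -> sym_spec z (inr k).
  by have [<- <-] := bs_vertexE k => xk yk; constructor; exact: circleP.
have xy := circleE z; rewrite /sym.
case: (ltrgtP (yco z) 0) => [y0|y0|y0].
- case: (ltrgtP (xco z) 0) => [x0|x0|x0]; try by constructor.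
  by apply: V => //=; nra.
- case: (ltrgtP (xco z) (-(3/5))) => [x0|x0|x0]; first by constructor.
    case: (ltrgtP (xco z) 0) => [x1|x1|x1].
    + by constructor => //; nra.
    + case: (ltrgtP (xco z) (3/5)) => [x2|x2|x2].
      * by constructor => //; nra.
      * by constructor.
      * by apply: V => //=; nra.
    + by apply: V => //=; nra.
  by apply: V => //=; nra.
- case: (ltrgtP (xco z) 0) => [x0|x0|x0]; first by apply: V => //=; nra.
  + by apply: V => //=; nra.
  + by move: xy; rewrite x0 y0 => /eqP; rewrite expr0n addr0 eq_sym oner_eq0.
Qed.

Lemma sym_vertex k : sym (bs_vertex R k) = inr k.
Proof.
case: sym_ofP;
  try by (have [-> ->] := bs_vertexE k; 
          elim/ord6_ind: k => /= *; exfalso; lra).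
move=> l kl; have [xk yk] := bs_vertexE k; have [xl yl] := bs_vertexE l.
move: xk yk; rewrite kl xl yl {kl xl yl}.
by elim/ord6_ind: k; elim/ord6_ind: l => //= *; exfalso; lra.
Qed.

Lemma sym_inr z k : sym z = inr k <-> z = bs_vertex R k.
Proof.
split=> [|->]; last exact: sym_vertex.
by case: sym_ofP => // l -> [->].
Qed.

(* Decides [(0 < e) = b] and [(0 <= e) = b] for a closed boolean [b]. *)
Ltac sign_cases := first
  [ transitivity true; [|by []]; apply/idP; first [lra | nra]
  | transitivity false; [|by []]; apply/negbTE; rewrite -?leNgt -?ltNge; first [lra | nra]].

Lemma arc_form_gt0 k z : (0 < arc_form k z) = (sym z == inl k).
Proof.
have xy := circleE z; have [x1 y1] := xyco_bound z.
case: sym_ofP; try by (move=> *; elim/ord6_ind: k; rewrite /arc_form /lin /=;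
  sign_cases).
by move=> l -> {xy x1 y1}; rewrite /arc_form /lin; have [-> ->] := bs_vertexE l;
  elim/ord6_ind: l; elim/ord6_ind: k => /=; sign_cases.
Qed.

Lemma arc_form_ge0 k z :
  (0 <= arc_form k z) = (sym z \in [:: inl k; inr k; inr (ordS k)]).
Proof.
have xy := circleE z; have [x1 y1] := xyco_bound z.
case: sym_ofP; try by (move=> *; elim/ord6_ind: k; rewrite /arc_form /lin /= ?ordS6;
  sign_cases).
by move=> l -> {xy x1 y1}; rewrite /arc_form /lin; have [-> ->] := bs_vertexE l;
  elim/ord6_ind: l; elim/ord6_ind: k; rewrite ?ordS6 /=;
  sign_cases.
Qed.

Lemma image_form_gt0 k z : (0 < image_form k z) = adm (inl k) (sym z).
Proof.
have xy := circleE z; have [x1 y1] := xyco_bound z.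
case: sym_ofP; try by (move=> *; elim/ord6_ind: k; rewrite /image_form /lin /adm /succ /=;
  sign_cases).
by move=> l -> {xy x1 y1}; rewrite /image_form /lin; have [-> ->] := bs_vertexE l;
  elim/ord6_ind: l; elim/ord6_ind: k => /=;
  sign_cases.
Qed.

End CircleSymbols.

(** * The action of the map on symbols *)

Section CircleDynamics.
Variable R : realType.
Implicit Types (z : circle R).

Definition cross (a b : circle R) : R := xco a * yco b - yco a * xco b.

(** The hypothesis says that the arc is shorter than half a turn. If [t] and [s] are the angles from
    [a] to [z] and to [b], the two determinants are [sin t] and [sin (s - t)]. *)
Lemma ccw_arcP (a b : circle R) z : 0 < cross a b ->
  ccw_arc a b z <-> 0 <= cross a z /\ 0 <= cross z b.
Proof.
have ca := circleE a; have cb := circleE b; have cz := circleE z.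
rewrite /cross => ab0; split.
- move=> [t [s [[t0 ts s2] [za ba]]]].
  have [xz yz] : xco z = xco a * cos t - yco a * sin t /\
                 yco z = xco a * sin t + yco a * cos t.
    by rewrite /xco /yco za; case: (val a : R[i]).
  have [xb yb] : xco b = xco a * cos s - yco a * sin s /\
                 yco b = xco a * sin s + yco a * cos s.
    by rewrite /xco /yco ba; case: (val a : R[i]).
  have ss : sin s = xco a * yco b - yco a * xco b.
    by rewrite xb yb -[LHS]mul1r -ca; ring.
  have spi : s < pi.
    rewrite ltNge; apply/negP => pis; move: ab0; rewrite -ss.
    have : 0 <= sin (s - pi).
      by apply: sin_ge0_pi; rewrite subr_ge0 pis/= lerBlDr; apply/ltW; lra.
    by rewrite sinB cospi sinpi; lra.
  split.
    have -> : xco a * yco z - yco a * xco z = sin t.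
      by rewrite xz yz -[RHS]mul1r -ca; ring.
    by apply: sin_ge0_pi; rewrite t0/=; lra.
  have -> : xco z * yco b - yco z * xco b = sin (s - t).
    by rewrite xz yz xb yb sinB -[RHS]mul1r -ca; ring.
  by apply: sin_ge0_pi; lra.
- move=> [az zb].
  have angle w : 0 <= xco a * yco w - yco a * xco w ->
      exists t, [/\ 0 <= t <= pi, cos t = xco a * xco w + yco a * yco w
                  & sin t = xco a * yco w - yco a * xco w].
    move=> aw; set c := xco a * xco w + yco a * yco w.
    have cw := circleE w.
    have c2 : 1 - c ^+ 2 = (xco a * yco w - yco a * xco w) ^+ 2.
      rewrite -[1]mulr1 -[X in X * 1]ca -[X in _ * X]cw /c; ring.
    have c1 : -1 <= c <= 1.
      by have := sqr_ge0 (xco a * yco w - yco a * xco w);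
        rewrite -c2 => h; apply/andP; split; nra.
    exists (acos c); split.
    + by rewrite acos_ge0// acos_lepi.
    + by rewrite acosK// in_itv.
    + by rewrite sin_acos// c2 sqrtr_sqr ger0_norm.
  have [t [/andP[t0 tpi] ct st]] := angle _ az.
  have [s [/andP[s0 spi] cs ss]] := angle _ (ltW ab0).
  have ss0 : 0 < sin s by rewrite ss.
  have polar (u : R) w : cos u = xco a * xco w + yco a * yco w ->
      sin u = xco a * yco w - yco a * xco w ->
      (val w : R[i]) = val a * (cos u +i* sin u)%C.
    move=> -> ->; apply/eqP; rewrite eq_complex.
    rewrite /xco /yco in ca *; case: (val w : R[i]) => wx wy.
    case: (val a : R[i]) ca => x y /= ca.
    by apply/andP; split; apply/eqP; rewrite -[LHS]mul1r -ca; ring.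
  exists t, s; split; last by split; exact: polar.
  split => //; last first.
    by apply: le_lt_trans spi _; rewrite ltr_pMl ?pi_gt0// ltr1n.
  have : 0 <= sin (s - t).
    have -> : sin (s - t) = xco z * yco b - yco z * xco b; last by [].
    rewrite sinB ct st cs ss -[RHS]mul1r -ca; ring.
  move=> sst; rewrite leNgt; apply/negP => st'.
  suff : 0 < sin (t - s) by rewrite -opprB sinN; lra.
  (* A difference [t - s] of [pi] or more would force [s = 0], against [0 < sin s]. *)
  apply: sin_gt0_pi; rewrite subr_gt0 st'/= ltNge; apply/negP => h.
  have s00 : s = 0 by lra.
  by move: ss0; rewrite s00 sin0 ltxx.
Qed.

Lemma bs_arcE k z : bs_arc k z <-> sym z \in [:: inl k; inr k; inr (ordS k)].
Proof.
rewrite -arc_form_ge0 /bs_arc.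
have xy := circleE z; have [x1 y1] := xyco_bound z.
have [xk yk] := bs_vertexE R k; have [xl yl] := bs_vertexE R (ordS k).
rewrite ccw_arcP /cross xk yk xl yl.
  elim/ord6_ind: k {xk yk xl yl}; rewrite ?ordS6 /arc_form /lin /=;
    (split=> [[h1 h2]|h]; [|split]); nra.
by elim/ord6_ind: k {xk yk xl yl}; rewrite ?ordS6 /=; lra.
Qed.

Lemma actVK (u : F2) z : act u (act u^-1%g z) = z.
Proof. by rewrite -actM mulgV. Qed.

Lemma actKV (u : F2) z : act u^-1%g (act u z) = z.
Proof. by rewrite -actM mulVg. Qed.

(** [alpha k] carries the chord of the arc to the chord of its image without exchanging the sides.
    The coefficients come from [lin_refl], applied to the reflections that compose [alpha k]. *)
Lemma image_formE k z :
  exists2 d, 0 < d & image_form k (act (alpha k) z) = d * arc_form k z.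
Proof.
have p1 : (-1 : R) ^+ 2 = 1 by rewrite sqrrN expr1n.
have r2 := lin_refl _ _ _ _ (expr1n _ 2) (@refl2E R).
have r3 := lin_refl _ _ _ _ p1 (@refl3E R).
have E a b c a' b' c' w : a = a' -> b = b' -> c = c' ->
  lin a b c w = lin a' b' c' w :> R by move=> -> -> ->.
elim/ord6_ind: k; rewrite /image_form /arc_form /=.
- have -> : act (alpha (O6 0)) z = refl3 (refl1 z) by [].
  have [d d0 ->] := r3 1 (-1) (-1) (refl1 z); exists d => //.
  by rewrite lin_refl1; congr (_ * _); apply: E; ring.
- have -> : act (alpha (O6 1)) z = refl2 (refl1 z) by [].
  have [d d0 ->] := r2 (-1) (-1) (-1) (refl1 z); exists d => //.
  by rewrite lin_refl1; congr (_ * _); apply: E; ring.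
- have -> : act (alpha (O6 2)) z = refl1 (refl2 z) by [].
  rewrite lin_refl1.
  have [d d0 ->] := r2 0 (-1) 0 z; exists d => //.
  by congr (_ * _); apply: E; ring.
(* In [h g^-1] the two complex conjugations in the middle cancel. *)
- have -> : act (alpha (O6 3)) z = refl3 (refl2 z).
    by rewrite -[refl2 z]refl1K.
  have [d d0 ->] := r3 1 (-1) (-1) (refl2 z).
  have [d' d'0 ->] := r2 (- 1 - 2 * -1 * -1 + 2 * -1 * -1)
    (- 2 * -1 * 1 - -1 + 2 * -1) (3 * -1 - 2 * -1 * 1 - 2 * -1) z.
  exists (d * d'); rewrite ?mulr_gt0// -[RHS]mulrA; congr (_ * (_ * _)).
  by apply: E; ring.
- have -> : act (alpha (O6 4)) z = refl2 (refl3 z).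
    by rewrite -[refl3 z]refl1K.
  have [d d0 ->] := r2 (-1) (-1) (-1) (refl3 z).
  have [d' d'0 ->] := r3 (- -1 - 2 * 1 * -1 + 2 * 1 * -1)
    (- 2 * 1 * -1 - -1 + 2 * -1) (3 * -1 - 2 * 1 * -1 - 2 * -1) z.
  exists (d * d'); rewrite ?mulr_gt0// -[RHS]mulrA; congr (_ * (_ * _)).
  by apply: E; ring.
- have -> : act (alpha (O6 5)) z = refl1 (refl3 z) by [].
  rewrite lin_refl1.
  have [d d0 ->] := r3 0 (-1) 0 z; exists d => //.
  by congr (_ * _); apply: E; ring.
Qed.

(** Being an equivalence for every [z], this also says that the inverse of [alpha k] sends the open
    image arc into the open arc, on which [bs_preimage] rests. *)
Lemma sym_alpha k z :
  (sym z == inl k) = adm (inl k) (sym (act (alpha k) z)).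
Proof.
rewrite -arc_form_gt0 -image_form_gt0.
by have [d d0 ->] := image_formE k z; rewrite pmulr_rgt0.
Qed.

Lemma refl3_pt_i : refl3 (pt_i R) = pt_i R.
Proof.
have [d0] := refl3E (pt_i R); have -> : xco (pt_i R) = 0 by [].
have -> : yco (pt_i R) = 1 by [].
move=> x y; apply: circleP; rewrite ?x ?y.
  by rewrite [RHS](_ : _ = 0)//; field; lra.
by rewrite [RHS](_ : _ = 1)//; field; lra.
Qed.

Lemma refl2_pt_i : refl2 (pt_i R) = pt_i R.
Proof.
have [d0] := refl2E (pt_i R); have -> : xco (pt_i R) = 0 by [].
have -> : yco (pt_i R) = 1 by [].
move=> x y; apply: circleP; rewrite ?x ?y.
  by rewrite [RHS](_ : _ = 0)//; field; lra.
by rewrite [RHS](_ : _ = 1)//; field; lra.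
Qed.

Lemma refl2_pt_1 : refl2 (pt_1 R) = pt_1 R.
Proof.
have [d0] := refl2E (pt_1 R); have -> : xco (pt_1 R) = 1 by [].
have -> : yco (pt_1 R) = 0 by [].
move=> x y; apply: circleP; rewrite ?x ?y.
  by rewrite [RHS](_ : _ = 1)//; field; lra.
by rewrite [RHS](_ : _ = 0)//; field; lra.
Qed.

Lemma refl3_pt_N1 : refl3 (pt_N1 R) = pt_N1 R.
Proof.
have [d0] := refl3E (pt_N1 R); have -> : xco (pt_N1 R) = -1 by [].
have -> : yco (pt_N1 R) = 0 by rewrite /yco /= oppr0.
move=> x y; apply: circleP; rewrite ?x ?y.
  by rewrite [RHS](_ : _ = -1)//; field; lra.
by rewrite [RHS](_ : _ = 0) ?/yco /= ?oppr0//; field; lra.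
Qed.

Lemma alpha_vertex k : act (alpha k) (bs_vertex R k) = bs_vertex R (vimage k).
Proof.
have r1N1 : refl1 (pt_N1 R) = pt_N1 R.
  by apply: circleP; rewrite ?(refl1E _).1 ?(refl1E _).2 /yco /= ?oppr0.
have r11 : refl1 (pt_1 R) = pt_1 R.
  by apply: circleP; rewrite ?(refl1E _).1 ?(refl1E _).2 /yco /= ?oppr0.
have r1Ni : refl1 (pt_Ni R) = pt_i R.
  by apply: circleP; rewrite ?(refl1E _).1 ?(refl1E _).2 /xco /yco /= ?oppr0 ?opprK.
have r1i : refl1 (pt_i R) = pt_Ni R by rewrite -r1Ni refl1K.
elim/ord6_ind: k.
- have -> : act (alpha (O6 0)) (bs_vertex R (O6 0)) = refl3 (refl1 (pt_N1 R)) by [].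
  by rewrite r1N1 refl3_pt_N1.
- have -> : act (alpha (O6 1)) (bs_vertex R (O6 1)) = refl2 (refl1 (pt_Ni R)) by [].
  by rewrite r1Ni refl2_pt_i.
- have -> : act (alpha (O6 2)) (bs_vertex R (O6 2)) = refl1 (refl2 (pt_1 R)) by [].
  by rewrite refl2_pt_1 r11.
- have -> : act (alpha (O6 3)) (bs_vertex R (O6 3)) =
    act (f2h * f2g^-1)%g (act f2g (pt_N1 R)) by [].
  rewrite actM actKV.
  have -> : act f2h (pt_N1 R) = refl3 (refl1 (pt_N1 R)) by [].
  by rewrite r1N1 refl3_pt_N1.
- have -> : act (alpha (O6 4)) (bs_vertex R (O6 4)) =
    act f2g (act f2h^-1 (pt_i R))%g by rewrite -actM.
  have -> : act f2h^-1%g (pt_i R) = refl1 (refl3 (pt_i R)) by [].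
  rewrite refl3_pt_i.
  have -> : act f2g (refl1 (pt_i R)) = refl2 (refl1 (refl1 (pt_i R))) by [].
  by rewrite refl1K refl2_pt_i.
- have -> : act (alpha (O6 5)) (bs_vertex R (O6 5)) =
    act (f2h^-1)%g (act f2h (pt_1 R)) by [].
  by rewrite actKV.
Qed.

Variable A : circle R -> circle R.
Hypothesis hA : is_higher_bowen_series A.

Lemma bs_sym z k : sym z \in [:: inl k; inr k] -> A z = act (alpha k) z.
Proof.
move=> zk; apply: hA.2; apply/bs_arcE; move: zk.
by rewrite !inE => /orP[->|->]; rewrite ?orbT.
Qed.

Lemma bs_image_vertex k : A (bs_vertex R k) = bs_vertex R (vimage k).
Proof. by rewrite (@bs_sym _ k) ?sym_vertex ?inE ?eqxx ?orbT// alpha_vertex. Qed.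

Lemma adm_sym z : adm (sym z) (sym (A z)).
Proof.
case sz: (sym z) => [k|k].
  by rewrite -sz (@bs_sym _ k) ?sz ?inE ?eqxx// -sym_alpha sz.
by move/sym_inr: sz => ->; rewrite bs_image_vertex sym_vertex /= eqxx.
Qed.

Lemma bs_inj x y : sym x = sym y -> A x = A y -> x = y.
Proof.
case sy: (sym y) => [k|k] sx.
  rewrite (@bs_sym x k) ?sx ?inE ?eqxx// (@bs_sym y k) ?sy ?inE ?eqxx// => e.
  by rewrite -[x](actKV (alpha k)) e actKV.
by move/sym_inr: sx => ->; move/sym_inr: sy => ->.
Qed.

Lemma bs_preimage k z : adm (inl k) (sym z) -> exists2 y, sym y = inl k & A y = z.
Proof.
move=> kz; have yk : sym (act (alpha k)^-1%g z) = inl k.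
  by apply/eqP; rewrite sym_alpha actVK.
by exists (act (alpha k)^-1%g z); rewrite // (@bs_sym _ k) ?yk ?inE ?eqxx// actVK.
Qed.

(** The interior of the image is reached by [bs_preimage]; its two ends are the images of the ends
    of the arc [i]. *)
Lemma bs_arc_succ i j : succ i j -> bs_arc j `<=` A @` bs_arc i.
Proof.
move=> ij z /bs_arcE zj.
have : adm (inl i) (sym z) \/ z = bs_vertex R (vimage i) \/
       z = bs_vertex R (vimage (ordS i)).
  case sz : (sym z) zj => [k|k].
    rewrite !inE orbF => /eqP[->]; by left.
  rewrite !inE /= => kj; move/sym_inr: sz => ->.
  have : (k == j) || (k == ordS j) by exact: kj.
  move: ij {kj}; elim/ord6_ind: i; elim/ord6_ind: j; rewrite ?ordS6 //=;
    move=> _; elim/ord6_ind: k => //= _;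
    first [by left | by right; left | by right; right].
case=> [/bs_preimage[y yi <-]|[->|->]].
- by exists y => //; apply/bs_arcE; rewrite yi inE eqxx.
- exists (bs_vertex R i); last exact: bs_image_vertex.
  by apply/bs_arcE; rewrite sym_vertex !inE eqxx orbT.
- exists (bs_vertex R (ordS i)); last exact: bs_image_vertex.
  by apply/bs_arcE; rewrite sym_vertex !inE eqxx !orbT.
Qed.

End CircleDynamics.

(** * Normal forms and the boundary of the free group *)

Section NormalForm.
Local Open Scope group_scope.

(** The edge labels along coded rays: with them, codes of boundary points become infinite normal
    forms. *)
Definition gen (i : 'I_6) : F2 := (alpha i)^-1.

Definition ginv (i : 'I_6) : 'I_6 :=
  nth ord0 [:: O6 5; O6 2; O6 1; O6 4; O6 3; O6 0] i.

(* The edges [i] and [gmerge i] issue from a common vertex of a triangle of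
   the Cayley graph: whenever neither [succ i j] nor [j = ginv i], one has
   [gen i * gen j = gen (gmerge i)]. *)
Definition gmerge (i : 'I_6) : 'I_6 :=
  nth ord0 [:: O6 1; O6 0; O6 3; O6 2; O6 5; O6 4] i.

(** Left multiplication by [gen i] on normal forms, the words whose consecutive letters satisfy
    [succ]: the new edge is kept, cancels, or is merged with the next one along a triangle. *)
Definition gpush (i : 'I_6) (w : seq 'I_6) : seq 'I_6 :=
  if w is j :: w' then
    if succ i j then i :: w else if j == ginv i then w' else gmerge i :: w'
  else [:: i].

Definition gprod (w : seq 'I_6) : F2 := \prod_(i <- w) gen i.

Definition letter_index (x : letter) : 'I_6 :=
  match x with
  | (false, false) => O6 2 | (false, true) => O6 1
  | (true, false) => O6 5 | (true, true) => O6 0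
  end.

Definition nf (u : F2) : seq 'I_6 := foldr gpush [::] (map letter_index (word u)).

Lemma ginvK : involutive ginv.
Proof. by elim/ord6_ind. Qed.

Lemma gen_inv i : gen (ginv i) = (gen i)^-1.
Proof. by elim/ord6_ind: i; apply: val_inj. Qed.

Lemma alpha_gen i : alpha i = gen (ginv i).
Proof. by rewrite gen_inv invgK. Qed.

Lemma gen_merge i j : ~~ succ i j -> j != ginv i ->
  gen i * gen j = gen (gmerge i).
Proof. by elim/ord6_ind: i; elim/ord6_ind: j => // _ _; apply: val_inj. Qed.

Lemma succ_ginv i j : succ (ginv j) (ginv i) = succ i j.
Proof. by elim/ord6_ind: i; elim/ord6_ind: j. Qed.

Lemma succ_ginvF i : succ i (ginv i) = false.
Proof. by elim/ord6_ind: i. Qed.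

Lemma succ_gmerge_l i j k : ~~ succ i j -> j != ginv i ->
  succ (gmerge i) k = succ j k.
Proof. by elim/ord6_ind: i; elim/ord6_ind: j => // _ _; elim/ord6_ind: k. Qed.

Lemma succ_gmerge_r i k : succ k (gmerge i) = succ k i.
Proof. by elim/ord6_ind: i; elim/ord6_ind: k. Qed.

Lemma gpush_sorted i w : sorted succ w -> sorted succ (gpush i w).
Proof.
case: w => //= j w jw; case: ifPn => [ij|ij] /=; first by rewrite ij.
case: ifPn => jgi; first exact: path_sorted jw.
by case: w jw => //= k w; rewrite (succ_gmerge_l _ ij jgi).
Qed.

Lemma gpushK i w : sorted succ w -> gpush i (gpush (ginv i) w) = w.
Proof.
case: w => [|j w] /=; first by rewrite succ_ginvF eqxx.
case: (boolP (succ (ginv i) j)) => [ij|ij] jw; first by rewrite /= succ_ginvF eqxx.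
rewrite ginvK; case: eqVneq => [ji|ji].
  subst j; case: w jw => //= k w /andP[ik _]; by rewrite ik.
rewrite /= succ_gmerge_r succ_ginvF.
have -> : (gmerge (ginv i) == ginv i) = false by elim/ord6_ind: (i).
congr (_ :: _); move: ij ji {jw w}; elim/ord6_ind: i; elim/ord6_ind: j => //.
Qed.

(** The generators 3 and 4 are products of two free letters, while [nf] pushes free letters one at a
    time; both routes must agree. *)
Lemma gpush_split w : sorted succ w ->
  gpush (O6 2) (gpush (O6 0) w) = gpush (O6 3) w /\
  gpush (O6 5) (gpush (O6 1) w) = gpush (O6 4) w.
Proof.
case: w => // j [_|k w]; first by elim/ord6_ind: j.
by elim/ord6_ind: j; elim/ord6_ind: k.
Qed.

Lemma gprod_cons i w : gprod (i :: w) = gen i * gprod w.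
Proof. by rewrite /gprod big_cons. Qed.

Lemma gprod_cat v w : gprod (v ++ w) = gprod v * gprod w.
Proof. exact: big_cat. Qed.

Lemma gprod_push i w : gprod (gpush i w) = gen i * gprod w.
Proof.
case: w => [|j w]; first by rewrite /= gprod_cons.
rewrite /=; case: ifPn => [ij|ij]; first by rewrite gprod_cons.
case: eqVneq => [->|ji]; first by rewrite gprod_cons gen_inv mulVKg.
by rewrite !gprod_cons mulgA gen_merge.
Qed.

Lemma nf_sorted u : sorted succ (nf u).
Proof. by rewrite /nf; elim: (map _ _) => //= i w; exact: gpush_sorted. Qed.

Lemma nfK u : gprod (nf u) = u.
Proof.
rewrite -[RHS]prod_letters /nf; elim: (word u) => [|x w IH].
  by rewrite /gprod !big_nil.
rewrite big_cons -IH /= gprod_push; congr (_ * _).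
by case: x => [[] []]; apply: val_inj.
Qed.

Lemma nf_letter x u : nf (letter_elt x * u) = gpush (letter_index x) (nf u).
Proof.
have lK y : letter_index (linv y) = ginv (letter_index y) by case: y => [[] []].
rewrite {1}/nf /=; case uw : (word u) => [|y w] /=; first by rewrite /nf uw.
case: eqVneq => [yx|yx] /=; last by rewrite /nf uw.
rewrite /nf uw /= yx lK gpushK//.
by elim: (map _ _) => //= i v; exact: gpush_sorted.
Qed.

Lemma nf_gen_mul i u : nf (gen i * u) = gpush i (nf u).
Proof.
have E x y v : letter_elt x * (letter_elt y * v) = letter_elt x * letter_elt y * v.
  by rewrite mulgA.
have [h3 h4] := gpush_split (nf_sorted u).
elim/ord6_ind: i.
- by rewrite -(nf_letter (true, true)); congr (nf (_ * _)); apply: val_inj.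
- by rewrite -(nf_letter (false, true)); congr (nf (_ * _)); apply: val_inj.
- by rewrite -(nf_letter (false, false)); congr (nf (_ * _)); apply: val_inj.
- rewrite -h3 -(nf_letter (true, true)) -(nf_letter (false, false)) E.
  by congr (nf (_ * _)); apply: val_inj.
- rewrite -h4 -(nf_letter (false, true)) -(nf_letter (true, false)) E.
  by congr (nf (_ * _)); apply: val_inj.
- by rewrite -(nf_letter (true, false)); congr (nf (_ * _)); apply: val_inj.
Qed.

Lemma nf_gprod_mul v u : nf (gprod v * u) = foldr gpush (nf u) v.
Proof.
elim: v => [|i v IH] /=; first by rewrite /gprod big_nil mul1g.
by rewrite gprod_cons -mulgA nf_gen_mul IH.
Qed.

Lemma foldr_gpush v w : sorted succ (v ++ w) -> foldr gpush w v = v ++ w.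
Proof.
elim: v => //= i v IH vw; rewrite IH; last exact: path_sorted vw.
by case: (v ++ w) vw => //= j s /andP[->].
Qed.

Lemma nf_gprod w : sorted succ w -> nf (gprod w) = w.
Proof.
by move=> sw; rewrite -[gprod w]mulg1 nf_gprod_mul foldr_gpush cats0.
Qed.

Lemma nf1 : nf 1 = [::]. Proof. by []. Qed.

Lemma size_gpush i w : (size (gpush i w) <= (size w).+1)%N.
Proof.
case: w => //= j w; case: ifP => // _; case: ifP => _ //=.
by rewrite ltnW.
Qed.

(** A push adds at most one edge, so no word representing [u] is shorter than [nf u]. *)
Lemma wlen_nf u : wlen u = size (nf u).
Proof.
apply/eqP; rewrite eqn_leq; apply/andP; split.
  have -> : size (nf u) = size (map ginv (nf u)) by rewrite size_map.
  rewrite -{1}[u]nfK; apply: leq_trans (wlen_le _).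
  rewrite big_map; apply/eq_leq; congr wlen; apply: eq_bigr => i _.
  by rewrite alpha_gen ginvK.
have [s <- <-] := wlenP u.
have -> : \prod_(i <- s) alpha i = gprod (map ginv s).
  by rewrite /gprod big_map; apply: eq_bigr => i _; rewrite alpha_gen.
rewrite -[gprod _]mulg1 nf_gprod_mul nf1.
elim: s => //= i s IH; exact: leq_trans (size_gpush _ _) _.
Qed.

Lemma gprod_inv w : (gprod w)^-1 = gprod (rev (map ginv w)).
Proof.
elim: w => [|i w IH]; first by rewrite /gprod !big_nil invg1.
rewrite gprod_cons invgM IH /= rev_cons -cats1 gprod_cat; congr (_ * _).
by rewrite /gprod big_seq1 gen_inv.
Qed.

Lemma sorted_inv w : sorted succ w -> sorted succ (rev (map ginv w)).
Proof.
rewrite rev_sorted sorted_map; apply: sub_sorted => i j /=.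
by rewrite succ_ginv.
Qed.

(* Normal forms with different first letters leave the identity through
   different edges; these may belong to the same triangle, whence [.+1]. *)
Lemma wlen_diverging a b : sorted succ a -> sorted succ b ->
    (forall i, ohead a = Some i -> ohead b <> Some i) ->
  (size a + size b <= (wlen ((gprod a)^-1 * gprod b)).+1)%N.
Proof.
move=> sa sb ab; rewrite wlen_nf gprod_inv nf_gprod_mul nf_gprod//.
have := sorted_inv sa; case: a sa ab => [|i a] sa ab.
  by rewrite /= add0n leqnSn.
rewrite /= rev_cons -cats1 foldr_cat /= => sai.
case: b sb ab => [|j b] sb ab.
  by rewrite foldr_gpush// size_cat size_rev size_map /= addn0 addn1.
have ji : j != i by apply/eqP => e; apply: (ab i) => //=; rewrite e.
rewrite /= ginvK (negPf ji).
have sri : sorted succ (rcons (rev (map ginv a)) (ginv i)) by rewrite -cats1.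
have col k w : succ^~ k =1 succ^~ (ginv i) -> path succ k w ->
    sorted succ (rev (map ginv a) ++ k :: w).
  move=> ki kw; rewrite sorted_cat_cons kw andbT; move: sri.
  by case: (rev _) => //= x s; rewrite !rcons_path ki.
case: ifPn => [ij|ij].
  rewrite foldr_gpush ?size_cat ?size_rev ?size_map/=; first by lia.
  by apply: col => //=; rewrite ij; exact: sb.
rewrite foldr_gpush ?size_cat ?size_rev ?size_map/=; first by lia.
apply: col => [k|]; first by rewrite succ_gmerge_r.
by case: b sb {ab} => //= k b; rewrite (succ_gmerge_l _ ij)// ginvK.
Qed.

Lemma sorted_mkseq (i : nat -> 'I_6) n :
  (forall k, succ (i k) (i k.+1)) -> sorted succ (mkseq i n).
Proof.
move=> si; suff P m k : path succ (i m) (map i (iota m.+1 k)).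
  by case: n => //= n; exact: P.
by elim: k m => //= k IH m; rewrite si IH.
Qed.

End NormalForm.

(** * Boundary points as infinite admissible words *)

Section Boundary.
Local Open Scope group_scope.

Lemma prefix_take (T : eqType) (p s : seq T) n : prefix p s -> size p = n ->
  take n s = p.
Proof. by move=> /prefixP[t ->] <-; rewrite take_size_cat. Qed.

Lemma longest_common_prefix (T : eqType) (s t : seq T) : exists p a b,
  [/\ s = p ++ a, t = p ++ b & forall i, ohead a = Some i -> ohead b <> Some i].
Proof.
elim: s t => [|x s IH] t; first by exists [::], [::], t.
case: t => [|y t]; first by exists [::], (x :: s), [::].
have [<-|xy] := eqVneq x y.
  by have [p [a [b [-> -> ab]]]] := IH t; exists (x :: p), a, b.
exists [::], (x :: s), (y :: t); split=> // i [<-] [yx].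
by rewrite yx eqxx in xy.
Qed.

(** Write the normal forms as [p a] and [p b] with [p] the longest common prefix. By
    [wlen_diverging], [a^-1 b] has length [|a| + |b|] or one less, so the Gromov product is [|p|] or
    [|p| + 1/2]. *)
Lemma gromov_productP u v N : (N%:R <= gromov_product u v)%R <->
  exists p, [/\ size p = N, prefix p (nf u) & prefix p (nf v)].
Proof.
rewrite /gromov_product ler_pdivlMr// -natrD lerBrDr -natrM -natrD ler_nat.
rewrite !wlen_nf; split.
- have [p [a [b [uE vE ab]]]] := longest_common_prefix (nf u) (nf v).
  have := nf_sorted u; have := nf_sorted v; rewrite uE vE.
  move=> /cat_sorted2[_ sb] /cat_sorted2[_ sa].
  have := wlen_diverging sa sb ab.
  have -> : (gprod a)^-1 * gprod b = u^-1 * v.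
    rewrite -[u]nfK -[v]nfK uE vE !gprod_cat invgM -mulgA; congr (_ * _).
    by rewrite mulKg.
  rewrite /wdist !size_cat; move: (wlen _) => w ab1 Nuv.
  have Np : (N <= size p)%N.
    by move: Nuv ab1; move: (size p) (size a) (size b) => x y z; lia.
  exists (take N p); split; first by rewrite size_takel.
    by rewrite -[X in prefix _ (X ++ _)](cat_take_drop N) -catA prefix_prefix.
  by rewrite -[X in prefix _ (X ++ _)](cat_take_drop N) -catA prefix_prefix.
- move=> [p [pN /prefixP[a uE] /prefixP[b vE]]].
  have -> : wdist u v = wlen ((gprod a)^-1 * gprod b).
    rewrite /wdist -[u]nfK -[v]nfK uE vE !gprod_cat invgM -mulgA.
    by rewrite mulKg.
  have := wlenM (gprod a)^-1 (gprod b); rewrite wlenV uE vE !size_cat pN.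
  have := nf_sorted u; have := nf_sorted v; rewrite uE vE.
  move=> /cat_sorted2[_ sb] /cat_sorted2[_ sa].
  rewrite (wlen_nf (gprod a)) (wlen_nf (gprod b)) (nf_gprod sa) (nf_gprod sb).
  by move: (size a) (size b) (wlen _) => x y z; lia.
Qed.

Definition ray_code (r : geodesic_ray) (k : nat) : 'I_6 :=
  head ord0 (nf ((val r k)^-1 * val r k.+1)).

Lemma rayP (r : geodesic_ray) : is_geodesic_ray (val r).
Proof. by have /asboolP := valP r. Qed.

Lemma nf_gen i : nf (gen i) = [:: i].
Proof. by rewrite -[gen i]mulg1 nf_gen_mul. Qed.

Lemma ray_step r k : val r k.+1 = val r k * gen (ray_code r k).
Proof.
have [_ /(_ k k.+1 (leqnSn _))] := rayP r; rewrite subSnn /wdist wlen_nf /ray_code.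
move: (_^-1 * _) (mulKg (val r k)^-1 (val r k.+1)); rewrite invgK => x <-.
rewrite -[in _ * x](nfK x); case: (nf x) => [|i [|]]//= _.
by rewrite /gprod big_seq1.
Qed.

Lemma ray_code_succ r k : succ (ray_code r k) (ray_code r k.+1).
Proof.
have [_ /(_ k k.+2 (leq_trans (leqnSn _) (leqnSn _)))] := rayP r.
rewrite /wdist !ray_step mulgA mulKg wlen_nf nf_gen_mul nf_gen /=.
have -> : (k.+2 - k = 2)%N by lia.
by case: ifP => //; case: ifP.
Qed.

Lemma nf_ray r n : nf (val r n) = mkseq (ray_code r) n.
Proof.
rewrite -[RHS]nf_gprod; last exact/sorted_mkseq/ray_code_succ.
congr nf; elim: n => [|n IH]; first by rewrite (rayP r).1 /gprod big_nil.
by rewrite ray_step IH mkseqS -cats1 gprod_cat /gprod big_seq1.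
Qed.

Lemma prefix_mkseq (T : eqType) (f : nat -> T) n p :
  prefix p (mkseq f n) -> p = mkseq f (size p).
Proof.
move=> pf; have pn : (size p <= n)%N by rewrite -(size_mkseq f n) size_prefix.
rewrite -[LHS](prefix_take pf erefl) /mkseq -map_take take_iota.
by rewrite (minn_idPl pn).
Qed.

Lemma asymptotic_code (r s : geodesic_ray) :
  asymptotic r s -> ray_code r =1 ray_code s.
Proof.
(* At time [n] the Gromov product is at least [n - C / 2], hence at least [k + 1]. *)
move=> /asboolP[C rs] k; set n := (k + C).+1.
have : (k.+1%:R <= gromov_product (val r n) (val s n))%R.
  rewrite /gromov_product ler_pdivlMr// -natrD lerBrDr -natrM -natrD ler_nat.
  by rewrite !wlen_nf !nf_ray !size_mkseq; have := rs n; rewrite /n; lia.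
move=> /gromov_productP[p [pk]]; rewrite !nf_ray.
move=> /prefix_mkseq; rewrite pk => -> /prefix_mkseq; rewrite size_mkseq.
by move=> /(congr1 (nth ord0 ^~ k)); rewrite !nth_mkseq.
Qed.

Definition code (xi : boundary) : nat -> 'I_6 := ray_code (repr xi).

Lemma code_pt r : code (boundary_pt r) =1 ray_code r.
Proof.
apply: asymptotic_code; apply/eqmodP.
by rewrite /boundary_pt reprK.
Qed.

Lemma boundary_ptK xi : boundary_pt (repr xi) = xi.
Proof. exact: reprK. Qed.

Lemma code_succ xi k : succ (code xi k) (code xi k.+1).
Proof. exact: ray_code_succ. Qed.

Lemma mkseq_eq1 (T : Type) (f g : nat -> T) n : f =1 g -> mkseq f n = mkseq g n.
Proof. by move=> fg; apply: eq_map. Qed.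

Lemma codesP i xi : codes i xi <-> i =1 code xi.
Proof.
split=> [[r <- ri] k|ic].
  rewrite code_pt /ray_code !ri big_ord_recr /= mulKg.
  by rewrite -/(gen _) nf_gen.
exists (repr xi); first exact: boundary_ptK.
move=> n; rewrite -[LHS]nfK nf_ray /gprod big_map.
rewrite -(big_mkord xpredT (fun k => (alpha (i k))^-1)) /index_iota subn0.
apply: eq_bigr => k _.
by rewrite ic.
Qed.

Lemma shadow_vertex xi N (u : F2) :
  shadow xi N (inl u) <-> prefix (mkseq (code xi) N) (nf u).
Proof.
split=> [[r <-]|xu].
  move=> [M _ rM]; have {rM} := rM (maxn M N) (leq_maxl _ _).
  move=> /gromov_productP[p [pN]]; rewrite nf_ray => /prefix_mkseq ->.
  by rewrite pN (mkseq_eq1 _ (code_pt r)).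
exists (repr xi); first exact: boundary_ptK.
exists N => //= n Nn; apply/gromov_productP; exists (mkseq (code xi) N).
by rewrite size_mkseq nf_ray /mkseq -(subnKC Nn) iotaD map_cat prefix_prefix.
Qed.

Lemma shadow_boundary xi N (eta : boundary) :
  shadow xi N (inr eta) <-> mkseq (code xi) N = mkseq (code eta) N.
Proof.
split=> [[r <- [s <-]]|xe].
  move=> [M _ rM]; have {rM} := rM (maxn M N) (leq_maxl _ _).
  move=> /gromov_productP[p [pN]]; rewrite !nf_ray => /prefix_mkseq -> /prefix_mkseq.
  by rewrite size_mkseq pN (mkseq_eq1 _ (code_pt r)) (mkseq_eq1 _ (code_pt s)).
exists (repr xi); first exact: boundary_ptK.
exists (repr eta); first exact: boundary_ptK.
exists N => //= n Nn; apply/gromov_productP; exists (mkseq (code xi) N).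
rewrite size_mkseq {2}xe !nf_ray /mkseq -(subnKC Nn) iotaD !map_cat.
by rewrite !prefix_prefix.
Qed.

Lemma shift_geodesic (r : geodesic_ray) :
  is_geodesic_ray (fun n => (val r 1%N)^-1 * val r n.+1).
Proof.
split=> [|m n mn]; first by rewrite mulVg.
rewrite /wdist invgM invgK -mulgA mulVKg.
by have [_ /(_ m.+1 n.+1)] := rayP r; rewrite /wdist subSS => ->.
Qed.

Definition boundary_shift (xi : boundary) : boundary :=
  boundary_pt (exist (fun r => `[< is_geodesic_ray r >]) _
                 (asboolT (shift_geodesic (repr xi)))).

Lemma code_shift xi : code (boundary_shift xi) =1 seq_shift (code xi).
Proof.
move=> k; rewrite /boundary_shift code_pt /ray_code /=.
by rewrite invgM invgK -mulgA mulVKg.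
Qed.

End Boundary.

(** * The Patterson-Sullivan measure of cylinders *)

Section Cylinders.

Definition cyl (p : seq 'I_6) : set boundary :=
  [set xi | mkseq (code xi) (size p) = p].

(** This extension of the cylinder to the vertices is clopen, so its indicator is a test function
    for weak convergence, and its mass under each [ps_approx] is a finite sum. *)
Definition bord_cyl (p : seq 'I_6) : set bordification :=
  [set x | match x with inl u => prefix p (nf u) | inr xi => cyl p xi end].

Lemma bord_cyl_open p : open (bord_cyl p).
Proof.
suff : bordification_open (bord_cyl p) by [].
move=> xi pxi; exists (size p) => -[u|eta].
  by move=> /shadow_vertex; rewrite [mkseq _ _]pxi.
by move=> /shadow_boundary; rewrite [mkseq (code xi) _]pxi => e;
  rewrite /bord_cyl /cyl /= -e.
Qed.

Lemma bord_cylC_open p : open (~` bord_cyl p).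
Proof.
suff : bordification_open (~` bord_cyl p) by [].
move=> xi pxi; exists (size p) => -[u|eta].
  move=> /shadow_vertex xu pu; apply: pxi; rewrite /bord_cyl /cyl /=.
  rewrite -[LHS](prefix_take xu (size_mkseq _ _)).
  exact: prefix_take pu erefl.
by move=> /shadow_boundary xe pe; apply: pxi; rewrite /bord_cyl /cyl /= xe.
Qed.

Lemma boundary_open (U : set boundary) : open U <->
  exists2 V : set bordification, open V & inr @^-1` V = U.
Proof. by []. Qed.

Lemma continuous_inr : continuous (inr : boundary -> bordification).
Proof. by apply/continuousP => V oV; apply/boundary_open; exists V. Qed.

Lemma cyl_open p : open (cyl p).
Proof. by apply/boundary_open; exists (bord_cyl p) => //; exact: bord_cyl_open. Qed.

Lemma borel_open (T : ptopologicalType) (U : set T) :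
  open U -> measurable (U : set (borel T)).
Proof. exact: sub_gen_smallest. Qed.

Lemma continuous_borel (S T : ptopologicalType) (f : S -> T) : continuous f ->
  measurable_fun [set: borel S] (f : borel S -> borel T).
Proof.
move=> /continuousP cf; apply: (@measurability _ _ (borel S) (borel T) setT f (@open T)) => //.
move=> _ [V oV <-].
by rewrite setTI; apply: borel_open; exact: cf.
Qed.

Lemma prefix_rcons_sum p (s : seq 'I_6) :
  prefix p s = ((s == p) + \sum_(j : 'I_6) prefix (rcons p j) s)%N :> nat.
Proof.
have [/prefixP[t ->]|ps] := boolP (prefix p s); last first.
  have -> : s == p = false by apply: contraNF ps => /eqP ->; exact: prefix_refl.
  rewrite big1// => j _; apply/eqP; rewrite eqb0; apply: contra ps => /prefixP[t ->].
  by rewrite -cats1 -catA prefix_prefix.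
case: t => [|x t].
  rewrite cats0 eqxx big1// => j _; apply/eqP; rewrite eqb0.
  by apply/negP => /size_prefix; rewrite size_rcons ltnn.
have -> : p ++ x :: t == p = false.
  by rewrite -[X in _ == X]cats0 eqseq_cat// andbF.
have E j : prefix (rcons p j) (p ++ x :: t) = (j == x).
  by elim: p => [|y p IH] /=; rewrite ?prefix0s ?andbT ?eqxx.
by rewrite (bigD1 x)//= big1 => [|j jx]; rewrite E ?eqxx// (negPf jx).
Qed.

Lemma succ_sum i : (\sum_j succ i j = 4)%N.
Proof.
rewrite !big_ord_recl big_ord0; elim/ord6_ind: i; exact: erefl.
Qed.

Variable R : realType.

Definition ball_sum (n : nat) (p : seq 'I_6) : R :=
  \sum_(u <- ball_seq n | prefix p (nf u)) 4^-1 ^+ wlen u.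

(** Each length [m] from [size p] to [n] contributes the same mass: [4 ^ (m - size p)] normal forms
    extend [p], each of weight [4 ^ (- m)]. The empty word behaves differently, having six
    continuations. *)
Lemma ball_sumE n p : sorted succ p -> p != [::] ->
  ball_sum n p = (n.+1 - size p)%:R * 4^-1 ^+ size p.
Proof.
move: {2}(n.+1 - size p)%N (erefl (n.+1 - size p)%N) => k.
elim: k p => [|k IH] p kp sp p0.
  rewrite kp mul0r /ball_sum big1_seq// => u /andP[pu].
  rewrite mem_ball_seq wlen_nf => un; have := size_prefix pu.
  by move: kp un; move: (size p) (size (nf u)) => x y; lia.
have sn : (size p <= n)%N by move: kp; move: (size p) => x; lia.
rewrite /ball_sum big_mkcond /=.
rewrite (eq_bigr (fun u => (4^-1 ^+ wlen u) *+ (nf u == p) +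
  \sum_j (4^-1 ^+ wlen u) *+ prefix (rcons p j) (nf u))); last first.
  by move=> u _; rewrite -mulrb prefix_rcons_sum mulrnDr -sumrMnr.
rewrite big_split/= exchange_big/=.
have -> : \sum_(u <- ball_seq n) 4^-1 ^+ wlen u *+ (nf u == p) = 4^-1 ^+ size p :> R.
  rewrite (bigD1_seq (gprod p)) ?undup_uniq ?mem_ball_seq ?wlen_nf ?nf_gprod//=.
  rewrite eqxx mulr1n big1 ?addr0// => u up.
  by case: eqP => // pu; move: up; rewrite -pu nfK eqxx.
rewrite (eq_bigr (fun j => (k%:R * 4^-1 ^+ (size p).+1) *+ succ (last ord0 p) j)).
  rewrite sumrMnr succ_sum kp exprS -[k.+1]addn1 natrD mulrDl mul1r addrC; congr (_ + _).
  by move: (_ ^+ size p) => e; rewrite -[LHS]mulr_natr; field.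
move=> j _; case: (boolP (succ (last ord0 p) j)) => pj.
  rewrite mulr1n -(size_rcons p j).
  have sk : (n.+1 - size (rcons p j) = k)%N.
    by rewrite size_rcons; move: kp; move: (size p) => x; lia.
  rewrite -[in RHS]sk -IH ?sk//; last by case: (p).
    by rewrite /ball_sum [RHS]big_mkcond /=; apply: eq_bigr => u _; rewrite mulrb.
  by case: (p) sp p0 pj => //= x w xw _; rewrite rcons_path xw.
rewrite mulr0n big1// => u _; case: (boolP (prefix _ _)) => //.
move=> /prefixP[t ut]; move: (nf_sorted u); rewrite ut => /cat_sorted2[].
by case: (p) p0 pj => //= x w _ /negPf pj; rewrite rcons_path pj andbF.
Qed.

Lemma ps_approx_cyl n p : ps_approx R n (bord_cyl p : set (borel bordification)) =
  ((ball_mass R n)^-1 * ball_sum n p)%:E.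
Proof.
rewrite /ps_approx /= /mscale /= /ball_measure /= /msum /= EFinM; congr (_ * _)%E.
rewrite /ball_sum (big_nth 1%g) big_mkord -sumEFin [RHS]big_mkcond /=.
apply: eq_bigr => k _; rewrite /mscale /= diracE.
have -> : (inl (nth 1%g (ball_seq n) k) \in bord_cyl p) =
    prefix p (nf (nth 1%g (ball_seq n) k)) :> bool.
  by apply/idP/idP; rewrite inE.
by case: ifP => _; rewrite ?mule1 ?mule0.
Qed.

Lemma indic_continuous (T : topologicalType) (U : set T) :
  open U -> open (~` U) -> continuous (\1_U : T -> R).
Proof.
move=> oU oUC; apply/continuousP => V oV.
have -> : \1_U @^-1` V = (if `[< V 1 >] then U else set0) `|`
                         (if `[< V 0 >] then ~` U else set0).
  apply/seteqP; split=> [x|x]; rewrite /preimage /= indicE.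
    case: (pselect (U x)) => Ux.
      by rewrite mem_set// => V1; left; case: asboolP.
    by rewrite memNset// => V0; right; case: asboolP.
  move=> [|]; case: asboolP => // V1 Ux; first by rewrite mem_set.
  by rewrite memNset.
by apply: openU; case: ifP => // _; exact: open0.
Qed.

Variable mu : probability (borel boundary) R.
Hypothesis hmu : is_patterson_sullivan mu.

Lemma cyl_measurable p : measurable (cyl p : set (borel boundary)).
Proof. apply: borel_open; exact: cyl_open. Qed.

Lemma ps_cyl_cvg p :
  (fun n => ps_approx R n (bord_cyl p : set (borel bordification))) @ \oo -->
  mu (cyl p).
Proof.
have := hmu (indic_continuous (@bord_cyl_open p) (@bord_cylC_open p)).
have mW : measurable (bord_cyl p : set (borel bordification)).
  apply: borel_open; exact: bord_cyl_open.
have bnd : exists M : R, forall x, `|\1_(bord_cyl p) x| <= M.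
  by exists 1 => x; rewrite indicE ger0_norm ?ler0n// lern1 leq_b1.
move=> /(_ bnd).
have -> : (fun n => \int[ps_approx R n]_x (\1_(bord_cyl p) x)%:E)%E =
    (fun n => ps_approx R n (bord_cyl p : set (borel bordification))).
  by apply/funext => n; rewrite integral_indic// setIT.
have mi := continuous_borel continuous_inr.
rewrite (@ge0_integral_pushforward _ _ (borel boundary) (borel bordification) R
  inr mi mu setT)//=; last exact/measurable_EFinP/measurable_indic.
have -> : (\int[mu]_x (((fun x => (\1_(bord_cyl p) x)%:E) \o inr) x) = mu (cyl p))%E.
  transitivity (mu (cyl p `&` setT)); last by rewrite setIT.
  by rewrite -(integral_indic mu measurableT (cyl_measurable p)); apply: eq_integral.
by [].
Qed.

(** The approximating masses coincide at every stage, so [ball_mass] is never evaluated; additivity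
    over the next letter then yields the values in [prob_cyl]. *)
Lemma prob_cyl_eq p q : sorted succ p -> sorted succ q -> p != [::] -> q != [::] ->
  size p = size q -> prob mu (cyl p) = prob mu (cyl q).
Proof.
move=> sp sq p0 q0 pq; congr fine.
have E : (fun n => ps_approx R n (bord_cyl p : set (borel bordification))) =
         (fun n => ps_approx R n (bord_cyl q : set (borel bordification))).
  by apply/funext => n; rewrite !ps_approx_cyl !ball_sumE// pq.
have := @ps_cyl_cvg p; rewrite E => /cvg_lim <- //.
by apply/cvg_lim => //; exact: ps_cyl_cvg.
Qed.

Lemma cylE p xi : cyl p xi <-> forall k, (k < size p)%N -> code xi k = nth ord0 p k.
Proof.
rewrite /cyl /=; split=> [<- k|h]; first by rewrite size_mkseq => kp; rewrite nth_mkseq.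
apply: (@eq_from_nth _ ord0); rewrite size_mkseq// => k kp.
by rewrite nth_mkseq// h.
Qed.

Lemma code_measurable n :
  finitely_measurable (fun xi : borel boundary => code xi n).
Proof.
move=> i; apply: borel_open.
have -> : (fun xi => code xi n) @^-1` [set i] =
    \bigcup_(p in [set p | size p = n.+1 /\ nth ord0 p n = i]) cyl p.
  apply/seteqP; split=> [xi <-|xi [p [pn pi]] /cylE h] /=.
    exists (mkseq (code xi) n.+1); first by split; rewrite ?size_mkseq ?nth_mkseq.
    by apply/cylE => k; rewrite size_mkseq => kn; rewrite nth_mkseq.
  by rewrite h ?pn.
by apply: bigcup_open => p _; exact: cyl_open.
Qed.

Lemma cyl_rcons p j : cyl p `&` (fun xi => code xi (size p)) @^-1` [set j] =
  cyl (rcons p j).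
Proof.
apply/seteqP; split=> xi; rewrite /cyl /= size_rcons mkseqS.
  by move=> [-> ->].
by move=> /eqP; rewrite eqseq_rcons => /andP[/eqP ? /eqP].
Qed.

Lemma cyl_nonadm p : ~~ sorted succ p -> cyl p = set0.
Proof.
move=> np; apply/seteqP; split=> // xi; rewrite /cyl /= => pxi.
by move: np; rewrite -pxi sorted_mkseq//; exact: code_succ.
Qed.

Lemma prob_cyl1 i : prob mu (cyl [:: i]) = 6^-1.
Proof.
have := prob_partition mu (code_measurable 0) measurableT.
rewrite probT (eq_bigr (fun=> prob mu (cyl [:: i]))) => [|j _]; last first.
  rewrite -(@prob_cyl_eq [:: j])// -(cyl_rcons [::] j); congr (prob _ (_ `&` _)).
  by apply/seteqP.
by rewrite sumr_const card_ord => e; lra.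
Qed.

Lemma prob_cyl_rcons p j : sorted succ (rcons p j) -> p != [::] ->
  prob mu (cyl p) = 4 * prob mu (cyl (rcons p j)).
Proof.
move=> spj p0; have [sp pj] : sorted succ p /\ succ (last ord0 p) j.
  by case: (p) p0 spj => //= x w _; rewrite rcons_path => /andP.
rewrite -(prob_partition mu (code_measurable (size p)) (cyl_measurable p)).
rewrite (eq_bigr (fun k => prob mu (cyl (rcons p j)) *+ succ (last ord0 p) k)).
  by rewrite sumrMnr succ_sum mulr_natl.
move=> k _; rewrite cyl_rcons; case: (boolP (succ _ k)) => pk.
  rewrite mulr1n; apply: prob_cyl_eq; rewrite ?size_rcons// -?size_eq0 ?size_rcons//.
  by case: (p) p0 sp pk => //= x w _ xw; rewrite rcons_path xw.
rewrite cyl_nonadm ?prob0//; apply: contra pk.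
by case: (p) p0 => //= x w _; rewrite rcons_path => /andP[].
Qed.

Lemma prob_cyl p : sorted succ p -> p != [::] ->
  prob mu (cyl p) = 6^-1 * 4^-1 ^+ (size p).-1.
Proof.
elim/last_ind: p => // p j IH spj _; have [->|p0] := eqVneq p [::].
  by rewrite prob_cyl1 expr0 mulr1.
have sp : sorted succ p by move: spj; rewrite -cats1 => /cat_sorted2[].
have := prob_cyl_rcons spj p0; rewrite IH// size_rcons.
have -> : size p = (size p).-1.+1 by case: (p) p0.
by rewrite /= exprS => e; lra.
Qed.

End Cylinders.

(** * Entropy and Gibbs' inequality *)

Section FiniteEntropy.
Variable R : realType.

(** This is [ln y <= y - 1] at [y = q j / (M * p j)]. The total [M] is left general because the
    weights of words have bounded sum rather than sum 1. *)
Lemma gibbs (J : finType) (p q : J -> R) (M : R) :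
    (forall j, 0 <= p j) -> \sum_j p j = 1 -> (forall j, 0 <= q j) ->
    (forall j, 0 < p j -> 0 < q j) -> 0 < M -> \sum_j q j <= M ->
  - \sum_j p j * ln (p j) <= - \sum_j p j * ln (q j) + ln M.
Proof.
move=> p0 p1 q0 pq M0 qM.
have : \sum_j (p j * ln (q j) - p j * ln (p j) - p j * ln M) <= \sum_j (q j / M - p j).
  apply: ler_sum => j _; have := p0 j; rewrite le_eqVlt => /predU1P[<-|pj0].
    by rewrite !mul0r !subr0 divr_ge0// ltW.
  have qj0 := pq _ pj0; have r0 : 0 < q j / (M * p j) by rewrite divr_gt0// mulr_gt0.
  have -> : q j / M - p j = p j * (q j / (M * p j) - 1).
    by field; rewrite !gt_eqF.
  rewrite -!mulrBr ler_pM2l//.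
  have -> : ln (q j) - ln (p j) - ln M = ln (q j / (M * p j)).
    by rewrite ln_div ?posrE ?mulr_gt0// lnM ?posrE//; ring.
  have := @le_ln1Dx R (q j / (M * p j) - 1).
  by rewrite addrCA subrr addr0 => -> //; rewrite ltrBrDl subrr.
rewrite !sumrB -!mulr_suml p1 mul1r.
have : (\sum_j q j) / M <= 1 by rewrite ler_pdivrMr// mul1r.
lra.
Qed.

Lemma limn_esup_le (u : nat -> \bar R) (c : \bar R) :
  (\forall n \near \oo, (u n <= c)%E) -> (limn_esup u <= c)%E.
Proof.
move=> uc; apply: (@le_trans _ _ (ereal_sup (u @` [set n | (u n <= c)%E]))).
  by apply: ereal_inf_lbound; exists [set n | (u n <= c)%E].
by apply: ge_ereal_sup => _ [n /= un <-].
Qed.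

Lemma limn_esup_ge (u : nat -> \bar R) (c : \bar R) :
  (\forall n \near \oo, (c <= u n)%E) -> (c <= limn_esup u)%E.
Proof.
move=> uc; apply: le_ereal_inf_tmp => _ [V Voo <-].
have [n [Vn un]] : exists n, V n /\ (c <= u n)%E.
  have : \forall n \near \oo, V n /\ (c <= u n)%E by near do split.
  by move=> [N _ NV]; exists N; apply: NV => /=.
by apply: le_trans un _; apply: ereal_sup_ubound; exists n.
Unshelve. all: by end_near. Qed.

End FiniteEntropy.

(** * Expectation and entropy of finite-valued maps *)

Section FiniteExpectation.
Context d (T : measurableType d) (R : realType) (P : probability T R).

Definition Ex (J : finType) (phi : T -> J) (F : J -> R) : R :=
  \sum_j prob P (phi @^-1` [set j]) * F j.

Lemma sum_prob (J : finType) (phi : T -> J) : finitely_measurable phi ->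
  \sum_j prob P (phi @^-1` [set j]) = 1.
Proof.
move=> mphi; rewrite -(probT P) -(prob_partition P mphi measurableT).
by apply: eq_bigr => j _; rewrite setTI.
Qed.

Lemma finitely_measurable_comp (J J' : finType) (phi : T -> J) (g : J -> J') :
  finitely_measurable phi -> finitely_measurable (g \o phi).
Proof.
by move=> mphi i; rewrite comp_preimage; exact: finitely_measurable_preimage.
Qed.

Lemma prob_comp (J J' : finType) (phi : T -> J) (g : J -> J') j' :
    finitely_measurable phi ->
  prob P ((g \o phi) @^-1` [set j']) =
  \sum_(j | g j == j') prob P (phi @^-1` [set j]).
Proof.
move=> mphi; have mg := finitely_measurable_comp g mphi.
rewrite -(prob_partition P mphi (mg j')) [RHS]big_mkcond /=; apply: eq_bigr => j _.
case: eqP => [<-|gj].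
  by congr prob; apply/seteqP; split=> [x [_]|x /= <-].
rewrite [X in prob P X](_ : _ = set0) ?prob0//.
by apply/seteqP; split=> // x [/= xj' xj]; apply: gj; rewrite -xj' xj.
Qed.

Lemma Ex_comp (J J' : finType) (phi : T -> J) (g : J -> J') (F : J' -> R) :
  finitely_measurable phi -> Ex phi (F \o g) = Ex (g \o phi) F.
Proof.
move=> mphi; rewrite /Ex (partition_big g xpredT)//=; apply: eq_bigr => j' _.
rewrite prob_comp// mulr_suml; apply: eq_bigr => j /eqP <-.
by [].
Qed.

Lemma eq_Ex (J : finType) (phi : T -> J) (F G : J -> R) :
  (forall x, F (phi x) = G (phi x)) -> Ex phi F = Ex phi G.
Proof.
move=> FG; apply: eq_bigr => j _.
have [[x <-]|nj] := pselect (exists x, phi x = j); first by rewrite FG.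
rewrite [X in prob P X](_ : _ = set0) ?prob0 ?mul0r//.
by apply/seteqP; split=> // x /= xj; apply: nj; exists x.
Qed.

Lemma ExD (J : finType) (phi : T -> J) (F G : J -> R) :
  Ex phi (fun j => F j + G j) = Ex phi F + Ex phi G.
Proof. by rewrite /Ex -big_split; apply: eq_bigr => j _; rewrite mulrDr. Qed.

Lemma Ex_cst (J : finType) (phi : T -> J) (c : R) :
  finitely_measurable phi -> Ex phi (fun=> c) = c.
Proof. by move=> mphi; rewrite /Ex -mulr_suml sum_prob// mul1r. Qed.

Lemma Ex_indicator (J : finType) (phi : T -> J) (B : pred J) (c : R) :
    finitely_measurable phi ->
  Ex phi (fun j => if B j then c else 0) = prob P [set x | B (phi x)] * c.
Proof.
move=> mphi; have -> : [set x | B (phi x)] = (B \o phi) @^-1` [set true] by [].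
rewrite prob_comp// mulr_suml [RHS]big_mkcond /=; apply: eq_bigr => j _.
by case: (B j); rewrite ?mulr0.
Qed.

(** Each fibre of [phi] lies in a fibre of [g \o phi], so the logarithms compare termwise once both
    sums are indexed by [J]. *)
Lemma entropy_coarsening (J J' : finType) (phi : T -> J) (g : J -> J') :
    finitely_measurable phi ->
  - \sum_j' prob P ((g \o phi) @^-1` [set j']) *
            ln (prob P ((g \o phi) @^-1` [set j'])) <=
  - \sum_j prob P (phi @^-1` [set j]) * ln (prob P (phi @^-1` [set j])).
Proof.
move=> mphi; have mg := finitely_measurable_comp g mphi.
rewrite lerN2 -/(Ex (g \o phi) (fun j' => ln (prob P ((g \o phi) @^-1` [set j'])))).
rewrite -Ex_comp//; apply: ler_sum => j _ /=.
have := prob_ge0 P (phi @^-1` [set j]); rewrite le_eqVlt => /predU1P[<-|pj0].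
  by rewrite !mul0r.
rewrite ler_pM2l// ler_ln ?posrE//.
  by apply: prob_le => // x /= ->.
by apply: lt_le_trans pj0 _; apply: prob_le => // x /= ->.
Qed.

End FiniteExpectation.

Section Itineraries.
Variables (T : Type) (f : T -> T).

Definition itin (E : Type) (e : T -> E) (n : nat) (x : T) : seq E :=
  mkseq (fun k => e (iter k f x)) n.

Lemma size_itin E (e : T -> E) n x : size (itin e n x) = n.
Proof. exact: size_mkseq. Qed.

Lemma itinS E (e : T -> E) n x : itin e n.+1 x = e x :: itin e n (f x).
Proof.
rewrite /itin /mkseq /= (iotaDl 1 0 n) -map_comp; congr (_ :: _).
by apply: eq_map => k /=; rewrite -iterSr.
Qed.

Lemma behead_itin E (e : T -> E) n x : behead (itin e n.+1 x) = itin e n (f x).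
Proof. by rewrite itinS. Qed.

Lemma take_itin E (e : T -> E) m n x : (m <= n)%N -> take m (itin e n x) = itin e m x.
Proof. by move=> mn; rewrite /itin /mkseq -map_take take_iota (minn_idPl mn). Qed.

Lemma map_itin E E' (g : E -> E') (e : T -> E) n x :
  map g (itin e n x) = itin (g \o e) n x.
Proof. by rewrite /itin /mkseq -map_comp. Qed.

Definition titin E (e : T -> E) n x : n.-tuple E :=
  Tuple (introT eqP (size_itin e n x)).

End Itineraries.

Lemma sum_tuple_cons (R : nmodType) (E : finType) n (F : seq E -> R) :
  \sum_(t : n.+1.-tuple E) F t = \sum_(s : n.-tuple E) \sum_a F (a :: s).
Proof.
rewrite pair_big /= (reindex (fun p : n.-tuple E * E => [tuple of p.2 :: p.1]))//=.
exists (fun t : n.+1.-tuple E => ([tuple of behead t], thead t)).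
  by move=> [s a] _; rewrite theadE; congr pair; apply: val_inj.
by move=> t _; rewrite [RHS]tuple_eta.
Qed.

(** * Entropy bounded by the mean cost of a backward code *)

Section EntropyBound.
Context d (T : measurableType d) (R : realType) (P : probability T R).
Variables (f : T -> T) (E : finType) (e : T -> E).
Hypothesis mf : measurable_fun setT f.
Hypothesis Pf : preserves P f.
Hypothesis me : finitely_measurable e.

Lemma iter_measurable k : measurable_fun setT (iter k f).
Proof.
elim: k => [|k IH]; first exact: measurable_id.
exact: (measurableT_comp mf IH).
Qed.

Lemma finitely_measurable_titin n : finitely_measurable (titin f e n).
Proof.
move=> t; have -> : titin f e n @^-1` [set t] =
    \bigcap_(k in [set k | (k < n)%N]) (iter k f @^-1` (e @^-1` [set nth (e point) t k])).
  apply/seteqP; split=> [x xt k /= kn|x xt].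
    by rewrite -xt /= nth_mkseq.
  apply: val_inj; apply: (@eq_from_nth _ (e point)); rewrite ?size_itin ?size_tuple// => k kn.
  by rewrite nth_mkseq// xt.
apply: bigcap_measurableType => k _.
by rewrite -[X in measurable X]setTI; apply: iter_measurable => //; exact: me.
Qed.

Variables (b : nat) (Q : seq E -> R).
Hypothesis Q0 : forall s, 0 <= Q s.
Hypothesis Q1 : forall s, size s = b -> \sum_a Q (a :: s) <= 1.
Hypothesis Qpos : forall x, 0 < Q (itin f e b.+1 x).

(** By [Q1], [Q (a :: s)] is a transition weight for [a] given the [b] letters after it. A word of
    length [n + b] gets a factor for each of its first [n] letters; the last [b] are left uncoded,
    whence the total of at most [#|E| ^ b]. *)
Fixpoint weight (n : nat) (s : seq E) : R :=
  if n is m.+1 then Q (take b.+1 s) * weight m (behead s) else 1.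

Lemma weightS n s : weight n.+1 s = Q (take b.+1 s) * weight n (behead s).
Proof. by []. Qed.

Lemma weight_ge0 n s : 0 <= weight n s.
Proof. by elim: n s => [|n IH] s //=; rewrite mulr_ge0. Qed.

Lemma weight_itin_gt0 n x : 0 < weight n (itin f e (n + b) x).
Proof.
elim: n x => [|n IH] x; first by rewrite ltr01.
rewrite weightS take_itin ?ltnS ?leq_addl// addSn behead_itin.
by apply: mulr_gt0; [exact: Qpos|exact: IH].
Qed.

Lemma sum_weight n : \sum_(t : (n + b).-tuple E) weight n t <= (#|E| ^ b)%:R.
Proof.
elim: n => [|n IH].
  by rewrite (eq_bigr (fun=> 1)) // sumr_const card_tuple lexx.
apply: le_trans IH; rewrite (@sum_tuple_cons _ _ (n + b) (weight n.+1)).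
apply: ler_sum => s _; under eq_bigr do rewrite weightS /=.
rewrite -mulr_suml ler_piMl ?weight_ge0//.
by apply: Q1; rewrite size_takel// size_tuple leq_addl.
Qed.

Definition weight_cost : R := - Ex P (titin f e b.+1) (fun t => ln (Q t)).

Lemma Ex_weight n :
  - Ex P (titin f e (n + b)) (fun t => ln (weight n t)) = n%:R * weight_cost.
Proof.
elim: n => [|n IH].
  rewrite mul0r (@eq_Ex _ _ _ _ _ _ _ (fun=> 0)) ?Ex_cst ?oppr0//.
  - exact: finitely_measurable_titin.
  - by move=> x; exact: ln1.
have mt m := @finitely_measurable_titin m.
have Wpos x : 0 < weight n (behead (itin f e (n.+1 + b) x)).
  by rewrite addSn behead_itin; exact: weight_itin_gt0.
rewrite (@eq_Ex _ _ _ _ _ _ _ (fun t : (n.+1 + b).-tuple E =>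
    ln (Q (take b.+1 t)) + ln (weight n (behead t)))).
  rewrite ExD opprD mulrSr mulrDl mul1r addrC; congr (_ + _).
    rewrite -IH; congr (- _).
    (* The factors after the first only see the orbit of [f x]; invariance of [P] then replaces
       [f x] by [x]. *)
    have -> : Ex P (titin f e (n.+1 + b)) (fun t => ln (weight n (behead t))) =
        Ex P (titin f e (n + b) \o f) (fun t => ln (weight n t)).
      pose g (t : (n.+1 + b).-tuple E) : (n + b).-tuple E := [tuple of behead t].
      transitivity (Ex P (titin f e (n.+1 + b))
          ((fun t : (n + b).-tuple E => ln (weight n t)) \o g)).
        by [].
      rewrite Ex_comp//; congr Ex; apply/funext => x; apply: val_inj.
      exact: behead_itin.
    rewrite /Ex; apply: eq_bigr => t _; congr (_ * _).
    by rewrite comp_preimage /prob Pf//; exact: mt.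
  rewrite /weight_cost; congr (- _).
  have bn : (b.+1 <= n.+1 + b)%N by rewrite addSn ltnS leq_addl.
  have sg (t : (n.+1 + b).-tuple E) : size (take b.+1 t) == b.+1.
    by rewrite size_takel// size_tuple.
  pose g (t : (n.+1 + b).-tuple E) : b.+1.-tuple E := Tuple (sg t).
  transitivity (Ex P (titin f e (n.+1 + b)) ((fun t : b.+1.-tuple E => ln (Q t)) \o g)).
    by [].
  rewrite Ex_comp//; congr Ex; apply/funext => x; apply: val_inj.
  exact: take_itin.
move=> x; rewrite weightS lnM ?posrE//; last exact: Wpos.
by rewrite take_itin ?Qpos// addSn ltnS leq_addl.
Qed.

(* The words in the names of the visited atoms are coded with the weights
   [weight], whose total mass stays bounded. *)
Lemma entropy_bound (k : nat) (C : 'I_k -> set T) (g : E -> 'I_k) n :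
    (forall j, C j = (g \o e) @^-1` [set j]) ->
  shannon_entropy P (refinement f C (n := n)) <=
  n%:R * weight_cost + ln (#|E| ^ b)%:R.
Proof.
move=> CE; have mt := @finitely_measurable_titin (n + b).
pose G (t : (n + b).-tuple E) : {ffun 'I_n -> 'I_k} :=
  [ffun i : 'I_n => g (nth (e point) t i)].
have RE w : refinement f C w = (G \o titin f e (n + b)) @^-1` [set w].
  have lt (i : 'I_n) : (i < n + b)%N by apply: leq_trans (ltn_ord i) (leq_addr _ _).
  apply/seteqP; split=> [x xw|x /= <- i].
    by apply/ffunP => i; have := xw i; rewrite CE ffunE /= nth_mkseq.
  by rewrite CE ffunE /= nth_mkseq.
rewrite /shannon_entropy; under eq_bigr do rewrite RE.
apply: le_trans (entropy_coarsening P G mt) _.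
rewrite -Ex_weight; apply: gibbs.
- by move=> t; exact: prob_ge0.
- exact: sum_prob.
- by move=> t; exact: weight_ge0.
- move=> t; have [[x <-] _|nt] := pselect (exists x, titin f e (n + b) x = t).
    exact: weight_itin_gt0.
  rewrite [X in prob P X](_ : _ = set0) ?prob0 ?ltxx//.
  by apply/seteqP; split=> // x xt; apply: nt; exists x.
- by rewrite ltr0n expn_gt0; apply/orP; left; apply/card_gt0P; exists (e point).
- exact: sum_weight.
Qed.

Lemma partition_entropy_bound (k : nat) (C : 'I_k -> set T) (g : E -> 'I_k) :
    (forall j, C j = (g \o e) @^-1` [set j]) ->
  (partition_entropy P f C <= weight_cost%:E)%E.
Proof.
move=> CE; apply/lee_addgt0Pr => r r0; rewrite -EFinD; apply: limn_esup_le.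
pose c := ln (#|E| ^ b)%:R : R.
(* From this index on, the additive constant [c] is at most [n * r]. *)
exists (Num.truncn (`|c| / r)).+1 => // n /= cn.
have n0 : (0 < n)%N by exact: leq_trans cn.
rewrite lee_fin ler_pdivrMr ?ltr0n//.
apply: le_trans (entropy_bound n CE) _; rewrite mulrDl mulrC lerD2l.
apply: le_trans (ler_norm _) _; rewrite -ler_pdivrMl// mulrC.
apply/ltW; apply: lt_le_trans (truncnS_gt _) _.
by rewrite ler_nat.
Qed.

End EntropyBound.

(** * Approximating Borel sets by itinerary sets *)

Section Approximation.
Variables (X : ptopologicalType) (R : realType) (P : probability (borel X) R).
Variables (f : X -> X) (S : finType) (sy : X -> S).
Hypothesis mf : measurable_fun setT (f : borel X -> borel X).
Hypothesis msy : finitely_measurable (sy : borel X -> S).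
Hypothesis generating : forall (U : set X) x, open U -> U x ->
  exists n, forall y, itin f sy n y = itin f sy n x -> U y.

Definition itin_set (m : nat) (W : seq S -> bool) : set (borel X) :=
  [set x | W (itin f sy m x)].

Lemma itin_set_measurable m W : measurable (itin_set m W).
Proof.
have -> : itin_set m W = titin f sy m @^-1` [set t : m.-tuple S | W t] by [].
apply: finitely_measurable_preimage; exact: finitely_measurable_titin.
Qed.

Definition sdiff (A B : set (borel X)) := (A `\` B) `|` (B `\` A).

Lemma sdiff_measurable A B : measurable A -> measurable B -> measurable (sdiff A B).
Proof. by move=> mA mB; apply: measurableU; exact: measurableD. Qed.

(** These sets form a sigma-algebra. It contains the open sets, which by [generating] are countable
    unions of itinerary sets. *)
Definition approximable (A : set (borel X)) := measurable A /\
  forall r : R, 0 < r -> exists m W, prob P (sdiff A (itin_set m W)) <= r.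

Lemma approximableC A : approximable A -> approximable (~` A).
Proof.
move=> [mA aA]; split=> [|r /aA[m [W AW]]]; first exact: measurableC.
exists m, (fun s => ~~ W s).
have -> : itin_set m (fun s => ~~ W s) = ~` itin_set m W.
  by apply/seteqP; split=> x; rewrite /itin_set /= => /negP.
by rewrite /sdiff !setDE !setCK setUC (setIC _ A) (setIC (~` A)) -!setDE.
Qed.

Lemma approximableU A B : approximable A -> approximable B -> approximable (A `|` B).
Proof.
move=> [mA aA] [mB aB]; split=> [|r r0]; first exact: measurableU.
have r2 : 0 < r / 2 by rewrite divr_gt0.
have [m [V AV]] := aA _ r2; have [n [W BW]] := aB _ r2.
exists (m + n)%N, (fun s => V (take m s) || W (take n s)).
have -> : itin_set (m + n) (fun s => V (take m s) || W (take n s)) =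
    itin_set m V `|` itin_set n W.
  apply/seteqP; split=> x; rewrite /itin_set /= !take_itin ?leq_addr ?leq_addl//.
    by move/orP.
  by move=> h; apply/orP.
have mV := itin_set_measurable m V; have mW := itin_set_measurable n W.
apply: (@le_trans _ _ (prob P (sdiff A (itin_set m V) `|` sdiff B (itin_set n W)))).
  apply: prob_le.
  - by apply: sdiff_measurable; exact: measurableU.
  - by apply: measurableU; exact: sdiff_measurable.
  - by move=> x [[[?|?] /not_orP[? ?]]|[[?|?] /not_orP[? ?]]];
      [left; left|right; left|left; right|right; right].
apply: le_trans (prob_setU_le _ (sdiff_measurable mA mV) (sdiff_measurable mB mW)) _.
by rewrite [leRHS](splitr r) lerD.
Qed.

Lemma approximable0 : approximable set0.
Proof.
split=> [|r r0]; first exact: measurable0.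
exists 0%N, (fun=> false); rewrite [X in prob P X](_ : _ = set0) ?prob0 ?ltW//.
by apply/seteqP; split=> // x [[]//|[]].
Qed.

Lemma prob_nondecreasing (F : nat -> set (borel X)) (r : R) :
    (forall n, measurable (F n)) -> nondecreasing_seq F -> 0 < r ->
  exists N, prob P (\bigcup_n F n) - prob P (F N) <= r.
Proof.
move=> mF ndF r0; have mU : measurable (\bigcup_n F n) by exact: bigcup_measurable.
have : (fun n => P (F n)) @ \oo --> (prob P (\bigcup_n F n))%:E.
  by rewrite -probE//; exact: nondecreasing_cvg_mu.
move=> /fine_cvg /cvgrPdist_le /(_ _ r0)[N _ /(_ N (leqnn N)) /= h].
by exists N; apply: le_trans (ler_norm _) h.
Qed.

Lemma approximable_bigcup (F : nat -> set (borel X)) :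
  (forall n, approximable (F n)) -> approximable (\bigcup_n F n).
Proof.
move=> aF; have mF n : measurable (F n) by have [] := aF n.
have mU : measurable (\bigcup_n F n) by exact: bigcup_measurable.
split=> // r r0; have r2 : 0 < r / 2 by rewrite divr_gt0.
pose G n := \big[setU/set0]_(i < n) F i.
have aG n : approximable (G n).
  rewrite /G; elim: n => [|n IH]; first by rewrite big_ord0; exact: approximable0.
  by rewrite big_ord_recr; exact: approximableU.
have mG n : measurable (G n) by have [] := aG n.
have UG : \bigcup_n F n = \bigcup_n G n.
  apply/seteqP; split=> [x [n _ Fx]|x [n _]].
    by exists n.+1 => //; rewrite /G big_ord_recr; right.
  by rewrite /G -bigcup_mkord => -[i _ Fi]; exists i.
have ndG : nondecreasing_seq G.
  by move=> m n mn; exact/subsetPset/subset_bigsetU.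
have [N GN] := prob_nondecreasing mG ndG r2.
have [_ /(_ _ r2)[m [W GW]]] := aG N; exists m, W.
have mW := itin_set_measurable m W.
apply: (@le_trans _ _ (prob P ((\bigcup_n F n `\` G N) `|` sdiff (G N) (itin_set m W)))).
  apply: prob_le.
  - exact: sdiff_measurable.
  - by apply: measurableU; [exact: measurableD|exact: sdiff_measurable].
  - move=> x [[Ux Wx]|[Wx Ux]].
      have [Gx|Gx] := pselect (G N x); first by right; left.
      by left.
    by right; right; split=> // Gx; apply: Ux; rewrite UG; exists N.
apply: le_trans (prob_setU_le _ (measurableD mU (mG N)) (sdiff_measurable (mG N) mW)) _.
rewrite [leRHS](splitr r) lerD//; apply: le_trans GN.
by rewrite -UG prob_setD// UG; exact: bigcup_sup.
Qed.

Lemma open_approximable (U : set X) : open U -> approximable U.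
Proof.
move=> oU.
pose E n : seq S -> bool := fun s => `[< forall y, itin f sy n y = s -> U y >].
have -> : U = \bigcup_n itin_set n (E n).
  apply/seteqP; split=> [x Ux|x [n _ /asboolP]]; last exact.
  by have [n nU] := generating oU Ux; exists n => //; exact/asboolP.
apply: approximable_bigcup => n; split=> [|r r0]; first exact: itin_set_measurable.
exists n, (E n); rewrite [X in prob P X](_ : _ = set0) ?prob0 ?ltW//.
by rewrite /sdiff setDv setU0.
Qed.

Lemma measurable_approximable A : measurable A -> approximable A.
Proof.
move: A; apply: smallest_sub; last exact: open_approximable.
split; [exact: approximable0| |exact: approximable_bigcup].
by move=> A aA; rewrite setTD; exact: approximableC.
Qed.

(** Approximate each atom within [r / k] by an itinerary set and guess an atom whose set contains
    the observed itinerary. A wrong guess, or no candidate at all, places the point in one of the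
    [k] symmetric differences. *)
Lemma prediction (k : nat) (c : X -> 'I_k) (r : R) :
    finitely_measurable (c : borel X -> 'I_k) -> 0 < r ->
  exists m (pr : seq S -> 'I_k),
    prob P [set x : borel X | c x != pr (itin f sy m x)] <= r.
Proof.
move=> mc r0; have k0 : (0 < k)%N by apply: leq_ltn_trans (ltn_ord (c point)).
have rk : 0 < r / k%:R by rewrite divr_gt0// ltr0n.
have [mm mmP] := choice (fun j => (measurable_approximable (mc j)).2 _ rk).
have [W WP] := choice mmP.
pose m := (\max_(j < k) mm j)%N.
have mj j : (mm j <= m)%N by exact: leq_bigmax.
pose pr s := odflt (c point) [pick j | W j (take (mm j) s)].
exists m, pr.
have mW j := itin_set_measurable (mm j) (W j).
pose D j := sdiff (c @^-1` [set j]) (itin_set (mm j) (W j)).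
have mD j : measurable (D j) by apply: sdiff_measurable.
apply: (@le_trans _ _ (prob P (\big[setU/set0]_j D j))).
  apply: prob_le.
  - have -> : [set x | c x != pr (itin f sy m x)] =
       (fun x => (titin f sy m x, c x)) @^-1`
         [set t : m.-tuple S * 'I_k | t.2 != pr t.1] by [].
    apply: finitely_measurable_preimage.
    by apply: finitely_measurable_pair => //; exact: finitely_measurable_titin.
  - by apply: bigsetU_measurable => j _.
  - have sub j : D j `<=` \big[setU/set0]_j D j.
      by move=> x Dx; rewrite (bigD1 j)//=; left.
    move=> x; rewrite /= /pr; case: pickP => [j|none] /=.
      rewrite take_itin// => Wj cj; apply: (sub j); right; split=> //= cxj.
      by rewrite cxj eqxx in cj.
    move=> _; apply: (sub (c x)); left; split=> //.
    by rewrite /itin_set /=; have := none (c x); rewrite take_itin// => ->.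
apply: le_trans (prob_bigsetU_le _ mD) _.
apply: (@le_trans _ _ (\sum_(j < k) r / k%:R)); first by apply: ler_sum => j _; exact: WP.
by rewrite sumr_const card_ord -[_ *+ k]mulr_natr divfK// pnatr_eq0 -lt0n.
Qed.

End Approximation.

(** * Maximal entropy equalises the predecessors *)

Section MaximalEntropy.
Variables (X : ptopologicalType) (R : realType) (P : probability (borel X) R).
Variables (f : X -> X) (S : finType) (sy : X -> S) (tr : rel S) (D : nat).
Hypothesis mf : measurable_fun setT (f : borel X -> borel X).
Hypothesis Pf : preserves P (f : borel X -> borel X).
Hypothesis msy : finitely_measurable (sy : borel X -> S).
Hypothesis generating : forall (U : set X) x, open U -> U x ->
  exists n, forall y, itin f sy n y = itin f sy n x -> U y.
Hypothesis tr_sy : forall x, tr (sy x) (sy (f x)).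
Hypothesis D_gt0 : (0 < D)%N.
Hypothesis tr_pred : forall t, (\sum_s tr s t <= D)%N.

Definition word_set (w : seq S) : set (borel X) :=
  [set x | itin f sy (size w) x = w].

Lemma word_set_measurable w : measurable (word_set w).
Proof.
have -> : word_set w = itin_set f sy (size w) (pred1 w).
  by apply/seteqP; split=> x; rewrite /itin_set /word_set /= => /eqP.
exact: itin_set_measurable.
Qed.

Lemma ln_ge_1BV (y : R) : 0 < y -> 1 - y^-1 <= ln y.
Proof.
move=> y0; have yV : 0 < y^-1 by rewrite invr_gt0.
have := @le_ln1Dx R (y^-1 - 1); rewrite addrCA subrr addr0 lnV ?posrE//.
move=> h; have {}h : - ln y <= y^-1 - 1 by apply: h; lra.
lra.
Qed.

(** The expression vanishes at 0 with derivative [p - q]. By [ln_ge_1BV] it is at least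
    [x (p - q - x (p + q)) / (1 - x^2)], and the chosen [x] maximises the numerator. *)
Lemma perturbation_gain (p q : R) : 0 <= q -> q < p ->
  exists x, [/\ 0 < x, x < 1 & 0 < p * ln (1 + x) + q * ln (1 - x)].
Proof.
move=> q0 qp; pose x := (p - q) / (2 * (p + q)).
have pq : 0 < p + q by lra.
have x0 : 0 < x by rewrite divr_gt0//; lra.
have xpq : 2 * (x * (p + q)) = p - q by rewrite /x; field; lra.
have x1 : x < 1 by rewrite ltr_pdivrMr; lra.
clearbody x; exists x; split=> //.
have p0 : 0 <= p by lra.
have h1 : p * (1 - (1 + x)^-1) <= p * ln (1 + x).
  by rewrite ler_wpM2l// ln_ge_1BV//; lra.
have h2 : q * (1 - (1 - x)^-1) <= q * ln (1 - x).
  by rewrite ler_wpM2l// ln_ge_1BV//; lra.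
apply: lt_le_trans (lerD h1 h2).
have -> : p * (1 - (1 + x)^-1) + q * (1 - (1 - x)^-1) =
   x * (p - q - x * (p + q)) / ((1 + x) * (1 - x)).
  by field; apply/andP; split; lra.
have e : x * (p - q - x * (p + q)) = x * ((p - q) / 2).
  by rewrite (_ : p - q - x * (p + q) = (p - q) / 2)//; lra.
by rewrite e divr_gt0// mulr_gt0//; lra.
Qed.

Lemma partition_map (k : nat) (C : 'I_k -> set (borel X)) :
    measurable_partition C ->
  exists c : X -> 'I_k, forall j, C j = c @^-1` [set j].
Proof.
move=> [_ tC UC]; have cP x : exists j, C j x.
  by have : [set: borel X] x by []; rewrite -UC => -[j _ Cx]; exists j.
have [c cE] := choice cP; exists c => j; apply/seteqP; split=> [x Cx|x /= <-//].
apply: contrapT => /= cj; have : (C (c x) `&` C j) x by split.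
by move/trivIsetP: tC => ->//; apply/eqP.
Qed.

Lemma prob_pred_le a a' t w : tr a t -> tr a' t ->
    ((ln D%:R)%:E <= measure_entropy P (f : borel X -> borel X))%E ->
  prob P (word_set [:: a, t & w]) <= prob P (word_set [:: a', t & w]).
Proof.
move=> at_ a't; apply: contraTT; rewrite -!ltNge => pp.
set p := prob P (word_set [:: a, t & w]) in pp.
set q := prob P (word_set [:: a', t & w]) in pp.
have aa' : a != a' by apply: contraTneq pp => aa; rewrite /q /p aa ltxx.
have [x [x0 x1 gain]] := perturbation_gain (prob_ge0 P _ : 0 <= q) pp.
(* One quarter of the gain is conceded to the factor [1 - eps] of right guesses and one quarter to
   wrong guesses, which leaves the bound [ln D - G / 2]. *)
set G := _ + _ in gain; pose dl := G / 4.
have dl0 : 0 < dl by rewrite divr_gt0.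
apply: (@le_lt_trans _ _ (ln D%:R - G / 2)%:E); last by rewrite lte_fin; lra.
apply: ge_ereal_sup => _ [k [C [mC ->]]].
have [c cE] := partition_map mC.
have mc : finitely_measurable (c : borel X -> 'I_k).
  by move=> j; rewrite -cE; case: mC.
have k0 : 0 < k%:R :> R by rewrite ltr0n; apply: leq_ltn_trans (ltn_ord (c point)).
(* Coding weights: [1 - eps] for the letter predicted by the next [m] symbols,
   [eps / k] for the others; then 1/D, perturbed on the words [a t w] and
   [a' t w], for the symbols. *)
pose eps : R := 1 - expR (- dl).
have eps1 : eps < 1 by have := expR_gt0 (- dl); rewrite /eps; lra.
have eps0 : 0 < eps by rewrite /eps subr_gt0 expR_lt1; lra.
have lneps : ln (1 - eps) = - dl by rewrite /eps opprB addrC subrK expRK.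
have ek0 : 0 < eps / k%:R by rewrite divr_gt0.
have ek1 : eps / k%:R <= 1.
  by rewrite ler_pdivrMr// mul1r (le_trans (ltW eps1))// ler1n -(ltr0n R).
(* The cost of one wrong guess. With [eps] fixed, a prediction of error at most [dl / (1 + L)] keeps
   the mean cost of wrong guesses within [dl]. *)
pose L := - ln (eps / k%:R).
have L0 : 0 <= L by rewrite oppr_ge0 ln_le0.
have [m [pr prP]] := prediction P mf msy generating mc (divr_gt0 dl0 (ltr_pwDl ltr01 L0)).
set err := prob P _ in prP.
have err0 : 0 <= err by exact: prob_ge0.
have errL : err * L <= dl.
  have : err * (1 + L) <= dl by rewrite -ler_pdivlMr//; lra.
  lra.
pose e (y : X) : S * 'I_k := (sy y, c y).
have me : finitely_measurable (e : borel X -> _) by exact: finitely_measurable_pair.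
(* A window of [b.+1] symbols contains both the words to be perturbed, of length [size w + 2], and
   the [m] symbols used for guessing. *)
pose b := ((size w).+1 + m)%N.
pose pert (u : seq S) : R := 1 + (if take (size w).+2 u == [:: a, t & w] then x else
  if take (size w).+2 u == [:: a', t & w] then - x else 0).
pose guess (v : S * 'I_k) (u : seq S) : R :=
  if v.2 != pr (take m u) then eps / k%:R else 1 - eps.
(* On windows of full length the later symbols form a non-empty list, so the default [t] of [head]
   is not read. *)
pose Q (s : seq (S * 'I_k)) : R := if s is v :: s' then let u := map fst s in
  D%:R^-1 * pert u * guess v u * (tr v.1 (head t (map fst s')))%:R else 0.
have pert_gt0 u : 0 < pert u by rewrite /pert; case: ifP => _; [|case: ifP => _]; lra.
have guess_gt0 v u : 0 < guess v u by rewrite /guess; case: ifP => _ //; lra.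
have D0 : 0 < D%:R :> R by rewrite ltr0n.
have Q0 s : 0 <= Q s.
  case: s => [|v s] //=; rewrite mulr_ge0// ?ler0n//.
  by rewrite !mulr_ge0// ?invr_ge0 ?ler0n// ltW.
have Q1 s : size s = b -> \sum_v Q (v :: s) <= 1.
  move=> _; set u := map fst s; set t' := head t u.
  have -> : \sum_v Q (v :: s) = \sum_a1 \sum_c1 Q ((a1, c1) :: s).
    by rewrite pair_big; apply: eq_bigr => -[].
  have guess_sum a1 : \sum_c1 guess (a1, c1) (a1 :: u) <= 1.
    rewrite (bigD1 (pr (take m (a1 :: u))))//= /guess /= eqxx /=.
    rewrite (eq_bigr (fun=> eps / k%:R)) => [|c1 ->//].
    rewrite -lerBrDl; have -> : 1 - (1 - eps) = eps by rewrite subKr.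
    apply: (@le_trans _ _ (\sum_(c1 < k) eps / k%:R)).
      by rewrite big_mkcond /=; apply: ler_sum => c1 _; case: ifP => // _; exact: ltW.
    by rewrite sumr_const card_ord -[_ *+ k]mulr_natr divfK// gt_eqF.
  apply: (@le_trans _ _ (\sum_a1 D%:R^-1 * (pert (a1 :: u) * (tr a1 t')%:R))).
    apply: ler_sum => a1 _; rewrite /Q /= -/u -/t' -mulr_suml -mulr_sumr.
    rewrite mulrA ler_wpM2r ?ler0n// ler_piMr// mulr_ge0 ?invr_ge0 ?ler0n//.
    exact: ltW.
  rewrite -mulr_sumr -ler_pdivlMl ?invr_gt0// invrK mulr1.
  have trD : \sum_a1 (tr a1 t')%:R <= D%:R :> R by rewrite -natr_sum ler_nat.
  apply: le_trans trD.
  have takeE a1 a2 : (take (size w).+2 (a1 :: u) == [:: a2, t & w]) =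
      (a1 == a2) && (take (size w).+1 u == t :: w) by rewrite /= eqseq_cons.
  rewrite /pert; case: (boolP (take (size w).+1 u == t :: w)) => ut; last first.
    rewrite le_eqVlt; apply/orP; left; apply/eqP; apply: eq_bigr => a1 _.
    by rewrite !takeE (negPf ut) !andbF addr0 mul1r.
  have tE : t' = t by move/eqP: ut; rewrite /t'; case: (u) => //= z ? [].
  (* As [a] and [a'] both precede [t], the perturbations [x] and [- x] cancel in the sum over
     predecessors. *)
  rewrite (bigD1 a)//= (bigD1 a')//= 1?eq_sym//.
  rewrite [leRHS](bigD1 a)//= [X in _ <= _ + X](bigD1 a')//= 1?eq_sym//.
  rewrite !takeE ut !eqxx /= [a' == a]eq_sym (negPf aa') /= tE at_ a't !mulr1 !addrA.
  have -> : 1 + x + 1 - x = 1 + 1 by ring.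
  rewrite lerD2l; apply: ler_sum => a1 /andP[a1a a1a'].
  by rewrite !takeE (negPf a1a) (negPf a1a') addr0 mul1r.
have QE y : Q (itin f e b.+1 y) =
    D%:R^-1 * pert (itin f sy b.+1 y) * guess (e y) (itin f sy b.+1 y).
  have Qcons v s : Q (v :: s) = D%:R^-1 * pert (map fst (v :: s)) *
    guess v (map fst (v :: s)) * (tr v.1 (head t (map fst s)))%:R by [].
  have hd : head t (map fst (itin f e b (f y))) = sy (f y) by rewrite /b addSn itinS.
  by rewrite itinS Qcons hd tr_sy mulr1 -itinS (map_itin f fst e).
have Qpos y : 0 < Q (itin f e b.+1 y).
  by rewrite QE !mulr_gt0// invr_gt0.
apply: le_trans (@partition_entropy_bound _ _ _ P _ _ e mf Pf me b Q Q0 Q1 Qpos k C snd _) _.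
  by move=> j; rewrite cE.
pose F (s : seq (S * 'I_k)) := take (size w).+2 (map fst s).
pose wrong (s : seq (S * 'I_k)) := if s is v :: _ then
  v.2 != pr (take m (map fst s)) else false.
(* The logarithm of [Q] along itineraries, written as a sum of indicators; a wrong guess replaces
   [- dl] by [- L]. *)
rewrite lee_fin /weight_cost (@eq_Ex _ _ _ _ _ _ _ (fun s : b.+1.-tuple (S * 'I_k)%type =>
  - ln D%:R + ((if F s == [:: a, t & w] then ln (1 + x) else 0) +
  ((if F s == [:: a', t & w] then ln (1 - x) else 0) +
   (- dl + (if wrong s then - L + dl else 0)))))); last first.
  move=> y; have -> : tval (titin f e b.+1 y) = itin f e b.+1 y by [].
  rewrite QE lnM ?posrE//; last first.
    by rewrite mulr_gt0// invr_gt0.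
  rewrite lnM ?posrE ?invr_gt0// lnV ?posrE// -!addrA; congr (_ + _).
  rewrite addrA; congr (_ + _).
    rewrite /F (map_itin f fst e) /pert; case: ifP => [/eqP ->|_].
      by rewrite eqseq_cons (negPf aa') /= addr0.
    by case: ifP; rewrite ?add0r ?addr0 ?ln1.
  rewrite /guess /wrong -(map_itin f fst e) itinS /=.
  by case: ifP => _; rewrite ?addr0 ?lneps// /L opprK addrCA addNr addr0.
have mt := finitely_measurable_titin mf me (n := b.+1).
rewrite !ExD !Ex_cst// !Ex_indicator//.
have FE y : F (titin f e b.+1 y) = itin f sy (size w).+2 y.
  by rewrite /F (map_itin f fst e) take_itin// /b addSn !ltnS leq_addr.
have wordE v : size v = (size w).+2 ->
    [set y | F (titin f e b.+1 y) == v] = word_set v.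
  move=> vw; rewrite /word_set vw.
  by apply/seteqP; split=> y; rewrite /mkset FE => /eqP.
rewrite !wordE// -/p -/q.
have wrongE y : wrong (titin f e b.+1 y) = (c y != pr (itin f sy m y)).
  have wrong_cons v s : wrong (v :: s) = (v.2 != pr (take m (map fst (v :: s)))) by [].
  have -> : tval (titin f e b.+1 y) = itin f e b.+1 y by [].
  rewrite itinS wrong_cons -itinS (map_itin f fst e) take_itin//.
  by rewrite /b -addSn leq_addl.
have -> : [set y | wrong (titin f e b.+1 y)] = [set y | c y != pr (itin f sy m y)].
  by apply/seteqP; split=> y; rewrite /mkset wrongE.
rewrite -/err /dl in errL *; rewrite /G in errL *; nra.
Qed.

Lemma word_set_cons a s :
  word_set (a :: s) = f @^-1` word_set s `&` sy @^-1` [set a].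
Proof.
apply/seteqP; split=> x; rewrite /word_set /mkset [size _]/= itinS.
  by move=> [].
by move=> [/= -> ->].
Qed.

Lemma prob_word_sum s : \sum_a prob P (word_set (a :: s)) = prob P (word_set s).
Proof.
have mw := word_set_measurable s.
have mfw : measurable (f @^-1` word_set s : set (borel X)).
  by rewrite -[X in measurable X]setTI; exact: mf.
under eq_bigr do rewrite word_set_cons.
by rewrite (prob_partition P msy mfw) /prob Pf.
Qed.

Lemma word_set_nontr a t w : ~~ tr a t -> word_set [:: a, t & w] = set0.
Proof.
move=> at_; apply/seteqP; split=> // x; rewrite word_set_cons word_set_cons.
by move=> [[_ /= ft] /= xa]; move: at_; rewrite -ft -xa tr_sy.
Qed.

(** By [prob_pred_le] in both directions the [D] predecessors carry equal masses, and by invariance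
    these add up to the mass of the shorter word. *)
Lemma prob_word_cons a t w : (\sum_s tr s t = D)%N -> tr a t ->
    ((ln D%:R)%:E <= measure_entropy P (f : borel X -> borel X))%E ->
  prob P (word_set (t :: w)) = D%:R * prob P (word_set [:: a, t & w]).
Proof.
move=> tD at_ hD; rewrite -prob_word_sum.
rewrite (eq_bigr (fun s => prob P (word_set [:: a, t & w]) *+ tr s t)).
  by rewrite sumrMnr tD mulr_natl.
move=> s _; case: (boolP (tr s t)) => st; last by rewrite word_set_nontr ?prob0.
by apply/eqP; rewrite eq_le !prob_pred_le.
Qed.

End MaximalEntropy.

(** * A lower bound for the topological entropy *)

Section CircleTopology.
Variable R : realType.
Implicit Types z : circle R.

Lemma normc_ge_Im (w : R[i]) : `|complex.Im w|%:C%C <= `|w|.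
Proof.
rewrite normc_def lecR -sqrtr_sqr ler_wsqrtr// lerDr; exact: sqr_ge0.
Qed.

Lemma continuous_dominated (g : R[i] -> R) : {morph g : x y / x - y} ->
    (forall w, `|g w|%:C%C <= `|w|) ->
  continuous (g : R[i]^o -> R).
Proof.
move=> gB g_le z B /nbhs_ballP[r /= r0 rB]; apply/nbhs_ballP.
have r0C : 0 < (r%:C%C : R[i]) by rewrite ltcR.
exists (r%:C%C) => //= w; rewrite -ball_normE /= => zw; apply: rB.
by rewrite -ball_normE /= -gB -ltcR; apply: le_lt_trans zw.
Qed.

Lemma val_circle_continuous : continuous (fun z : circle R => val z : R[i]^o).
Proof. exact: initial_continuous. Qed.

Lemma xco_continuous : continuous (@xco R).
Proof.
move=> z; apply: (continuous_comp (@val_circle_continuous z)).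
by apply: continuous_dominated => [[? ?] [? ?]//|w]; exact: normc_ge_Re.
Qed.

Lemma yco_continuous : continuous (@yco R).
Proof.
move=> z; apply: (continuous_comp (@val_circle_continuous z)).
by apply: continuous_dominated => [[? ?] [? ?]//|w]; exact: normc_ge_Im.
Qed.

Lemma affine_continuous (T : topologicalType) (u v : T -> R) (a b c : R) :
  continuous u -> continuous v -> continuous (fun x => a * u x + b * v x - c).
Proof.
move=> cu cv x; apply: (@cvgB _ R^o); last exact: cvg_cst.
by apply: (@cvgD _ R^o); apply: cvgM; first [exact: cvg_cst|exact: cu|exact: cv].
Qed.

Lemma arc_form_continuous k : continuous (@arc_form R k).
Proof.
have lin_continuous a b c : continuous (@lin R a b c).
  exact: (@affine_continuous (circle R) (@xco R) (@yco R) a b c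
    xco_continuous yco_continuous).
by elim/ord6_ind: k; exact: lin_continuous.
Qed.

Lemma open_arc k : open [set z : circle R | sym z = inl k].
Proof.
have -> : [set z : circle R | sym z = inl k] = arc_form k @^-1` [set r | 0 < r].
  by apply/seteqP; split=> z /=; rewrite arc_form_gt0 => /eqP.
apply: open_comp; last exact: open_gt.
by move=> z _; exact: arc_form_continuous.
Qed.

Lemma open_arc_compl k :
  open [set z : circle R | sym z \notin [:: inl k; inr k; inr (ordS k)]].
Proof.
have -> : [set z : circle R | sym z \notin [:: inl k; inr k; inr (ordS k)]] =
    arc_form k @^-1` [set r | r < 0].
  by apply/seteqP; split=> z /=; rewrite -arc_form_ge0 -ltNge.
apply: open_comp; last exact: open_lt.
by move=> z _; exact: arc_form_continuous.
Qed.

(** The open star of [v]: the vertex with its two adjacent open arcs. *)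
Definition near_vertex (v : 'I_6) (s : symbol) : bool :=
  match s with inl k => (k == v) || (ordS k == v) | inr k => k == v end.

Definition symbols : seq symbol :=
  let o := [:: O6 0; O6 1; O6 2; O6 3; O6 4; O6 5] in map inl o ++ map inr o.

Lemma mem_symbols s : s \in symbols.
Proof. by case: s; elim/ord6_ind. Qed.

(** The star is the complement of the closed arcs that avoid [v]; in this form it is visibly
    open. *)
Lemma near_vertexP v s : near_vertex v s =
  all (fun k => (k != v) && (ordS k != v) ==>
    (s \notin [:: inl k; inr k; inr (ordS k)]))
    [:: O6 0; O6 1; O6 2; O6 3; O6 4; O6 5].
Proof. by case: s => k; elim/ord6_ind: v; elim/ord6_ind: k. Qed.

Lemma open_near_vertex v : open [set z : circle R | near_vertex v (sym z)].
Proof.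
under eq_set do rewrite near_vertexP.
elim: [:: _; _; _; _; _; _] => [|k s IH].
  by rewrite (_ : mkset _ = setT); [exact: openT|apply/seteqP].
rewrite (_ : mkset _ = [set z | (k != v) && (ordS k != v) ==>
    (sym z \notin [:: inl k; inr k; inr (ordS k)])] `&` [set z : circle R |
   all (fun k => (k != v) && (ordS k != v) ==>
    (sym z \notin [:: inl k; inr k; inr (ordS k)])) s]).
  apply: openI => //; case: (_ && _); first exact: open_arc_compl.
  by rewrite (_ : mkset _ = setT); [exact: openT|apply/seteqP].
by apply/seteqP; split=> z /= /andP.
Qed.

(* At a vertex the images of the two adjacent arcs lie on different sides of
   the image vertex. *)
Lemma adm_near_vertex v s s' t : near_vertex v s -> near_vertex v s' ->
  near_vertex (vimage v) t -> adm s t -> adm s' t -> s = s'.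
Proof.
have : all (fun v => all (fun s => all (fun s' => all (fun t =>
    near_vertex v s ==> near_vertex v s' ==> near_vertex (vimage v) t ==>
    adm s t ==> adm s' t ==> (s == s')) symbols) symbols) symbols)
    [:: O6 0; O6 1; O6 2; O6 3; O6 4; O6 5] by vm_compute.
have mv : v \in [:: O6 0; O6 1; O6 2; O6 3; O6 4; O6 5] by elim/ord6_ind: v.
move=> /allP/(_ _ mv)/allP/(_ _ (mem_symbols s))/allP/(_ _ (mem_symbols s')).
move=> /allP/(_ _ (mem_symbols t)).
move=> h vs vs' vt st st'; apply/eqP; move: h.
by rewrite vs vs' vt st st'.
Qed.

Lemma adm_pred_sum t : (\sum_s adm s t = 4)%N.
Proof.
rewrite big_sumType /= !big_ord_recl !big_ord0.
by case: t; elim/ord6_ind; exact: erefl.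
Qed.

Lemma sym_measurable : finitely_measurable (@sym R : borel (circle R) -> symbol).
Proof.
case=> k; first by apply: borel_open; exact: open_arc.
have -> : (@sym R) @^-1` [set inr k] = [set z | near_vertex k (sym z)] `&`
    (~` [set z | sym z = inl k] `&` ~` [set z | exists2 l, ordS l = k & sym z = inl l]).
  apply/seteqP; split=> [z /= ->|z /=]; first by rewrite /= eqxx; split=> //; split=> // -[].
  case: (sym z) => l /= [lk [nk nl]]; last by rewrite (eqP lk).
  by case/orP: lk => /eqP lk; [case: nk; rewrite lk|case: nl; exists l].
apply: measurableI; first by apply: borel_open; exact: open_near_vertex.
apply: measurableI; apply: measurableC; apply: borel_open; first exact: open_arc.
have -> : [set z | exists2 l, ordS l = k & @sym R z = inl l] =
    \bigcup_(l in [set l | ordS l = k]) [set z | sym z = inl l].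
  by apply/seteqP; split=> z /= [l lk zl]; exists l.
by apply: bigcup_open => l _; exact: open_arc.
Qed.

End CircleTopology.

(** * An open cover with injective members, and a count of preimages *)

Section TopologicalEntropy.
Variables (R : realType) (A : circle R -> circle R).
Hypothesis hA : is_higher_bowen_series A.

(** A whole star would be too large, since the images of two adjacent arcs overlap. Hence the image
    is also confined to the star of the image vertex, as [adm_near_vertex] requires. *)
Definition injectivity_cover (j : 'I_(6 + 6)) : set (circle R) :=
  match fintype.split j with
  | inl k => [set z | sym z = inl k]
  | inr v => [set z | near_vertex v (sym z)] `&`
             A @^-1` [set z | near_vertex (vimage v) (sym z)]
  end.

Lemma injectivity_cover_open : open_cover injectivity_cover.
Proof.
split=> [j|].
  rewrite /injectivity_cover; case: fintype.split => k; first exact: open_arc.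
  apply: openI; first exact: open_near_vertex.
  by move/continuousP: hA.1; apply; exact: open_near_vertex.
apply/seteqP; split=> // z _; case zs : (sym z) => [k|k].
  by exists (unsplit (inl k)) => //; rewrite /injectivity_cover unsplitK.
exists (unsplit (inr k)) => //; rewrite /injectivity_cover unsplitK /= zs /= eqxx.
split=> //.
by move/sym_inr: zs => ->; rewrite (bs_image_vertex hA) sym_vertex /= eqxx.
Qed.

Lemma injectivity_coverP j x y : injectivity_cover j x -> injectivity_cover j y ->
  A x = A y -> x = y.
Proof.
rewrite /injectivity_cover; case: fintype.split => [k /= xk yk|v /= [xv Axv] [yv _]] Axy.
  by apply: (bs_inj hA) => //; rewrite xk yk.
apply: (bs_inj hA) => //; apply: (adm_near_vertex xv yv Axv).
  exact: adm_sym hA _.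
by rewrite Axy; exact: adm_sym hA _.
Qed.

Lemma refinement_inj n (w : {ffun 'I_n -> 'I_(6 + 6)}) x y :
  refinement A injectivity_cover w x -> refinement A injectivity_cover w y ->
  iter n A x = iter n A y -> x = y.
Proof.
move=> xw yw xy; suff : forall k, (k <= n)%N -> iter (n - k) A x = iter (n - k) A y.
  by move=> /(_ n (leqnn n)); rewrite subnn.
elim=> [|k IH] kn; first by rewrite subn0.
have nk : (n - k.+1 < n)%N by rewrite ltn_subrL; case: (n) kn.
apply: (injectivity_coverP (xw (Ordinal nk)) (yw (Ordinal nk))).
by rewrite -!iterS subnSK//; exact: IH (ltnW kn).
Qed.

(** Staying in open arcs allows iteration: the four predecessors of an arc symbol are all arcs. *)
Lemma preimages (s : seq (circle R)) : uniq s ->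
    (forall x, x \in s -> exists k, sym x = inl k) ->
  exists s', [/\ uniq s', size s' = (4 * size s)%N &
    forall y, y \in s' -> A y \in s /\ exists k, sym y = inl k].
Proof.
elim: s => [|x s IH] /=; first by exists [::].
move=> /andP[xs us] ns.
have [|s' [us' ss' s'P]] := IH us; first by move=> y ys; apply: ns; rewrite inE ys orbT.
have [j xj] := ns _ (mem_head _ _).
have preP i : exists y, adm (inl i) (sym x) -> sym y = inl i /\ A y = x.
  have [/(bs_preimage hA)[y yi yx]|_] := boolP (adm (inl i) (sym x)); first by exists y.
  by exists x.
have [pre prP] := choice preP.
pose I := [seq i <- enum 'I_6 | adm (inl i) (sym x)].
have IP i : i \in I -> sym (pre i) = inl i /\ A (pre i) = x.
  by rewrite mem_filter => /andP[/prP].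
exists (map pre I ++ s'); split.
- rewrite cat_uniq us' andbT map_inj_in_uniq.
    rewrite filter_uniq ?enum_uniq//=; apply/hasPn => y /s'P[Ays _].
    by apply/mapP => -[i /IP[_ Ai] yi]; move: xs; rewrite -Ai -yi Ays.
  by move=> i i' /IP[si _] /IP[si' _] ii'; move: si; rewrite ii' si' => -[].
- rewrite size_cat ss' size_map mulnS; congr addn.
  rewrite size_filter -sum1_count big_mkcond big_enum /= xj.
  have := adm_pred_sum (inl j); rewrite big_sumType /= [X in (_ + X)%N]big1// addn0.
  by move=> e; rewrite -[RHS]e; apply: eq_bigr => i _; case: succ.
- move=> y; rewrite mem_cat => /orP[/mapP[i /IP[si Ai] ->]|/s'P[Ay ny]].
    by rewrite Ai mem_head; split=> //; exists i.
  by rewrite inE Ay orbT.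
Qed.

Lemma iterated_preimages (z : circle R) n : (exists k, sym z = inl k) ->
  exists s : seq (circle R), [/\ uniq s, size s = (4 ^ n)%N &
    forall y, y \in s -> iter n A y = z].
Proof.
move=> nz; suff [s [us ss sP]] : exists s : seq (circle R), [/\ uniq s, size s = (4 ^ n)%N &
    forall y, y \in s -> iter n A y = z /\ exists k, sym y = inl k].
  by exists s; split=> // y /sP[].
elim: n => [|n [s [us ss sP]]].
  by exists [:: z]; split=> // y; rewrite inE => /eqP ->.
have [|s' [us' ss' s'P]] := preimages us; first by move=> x /sP[].
exists s'; split=> //; first by rewrite ss' ss expnS.
by move=> y /s'P[/sP[Ay _] ny]; rewrite iterSr.
Qed.

Lemma interior_point : exists z : circle R, exists k, sym z = inl k.
Proof.
have n1 : `|(-(3/5) +i* -(4/5))%C : R[i]| = 1.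
  rewrite normc_def /= (_ : _ + _ = 1) ?sqrtr1//; by field.
exists (to_circle n1); case: sym_ofP => [||||||k zk]; try by move=> *; eexists.
exfalso; have [xk yk] := bs_vertexE R k.
by move: xk yk; rewrite -zk /xco /yco /=; elim/ord6_ind: k {zk} => /=; lra.
Qed.

(** By [refinement_inj], the [4 ^ n] preimages of one point under the [n]-th iterate lie in distinct
    members of any subcover. *)
Lemma cover_number_ge n : (4 ^ n <= cover_number (@refinement _ A _ injectivity_cover n))%N.
Proof.
rewrite /cover_number; elim/big_rec: _ => [|S m /asboolP cS mn].
  (* The default value of the minimum is [12 ^ n]. *)
  by rewrite card_ffun !card_ord; case: (n) => // k; rewrite leq_exp2r.
rewrite leq_min mn andbT.
have [z zk] := interior_point; have [s [us <- sP]] := iterated_preimages n zk.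
have wP x : exists w, w \in S /\ refinement A injectivity_cover w x.
  by have : [set: circle R] x by []; rewrite -cS => -[w /= wS xw]; exists w.
have [w wx] := choice wP.
rewrite cardE -(size_map w); apply: uniq_leq_size.
  rewrite map_inj_in_uniq// => x y /sP xz /sP yz wxy.
  apply: (@refinement_inj _ (w x)); first by have [] := wx x.
    by rewrite wxy; have [] := wx y.
  by rewrite xz yz.
by move=> _ /mapP[x _ ->]; rewrite mem_enum; have [] := wx x.
Qed.

Lemma topological_entropy_ge : ((ln 4%:R)%:E <= @topological_entropy R _ A)%E.
Proof.
apply: (@le_trans _ _ (cover_entropy R A injectivity_cover)); last first.
  apply: ereal_sup_ubound; exists (6 + 6)%N, injectivity_cover.
  by split=> //; exact: injectivity_cover_open.
apply: limn_esup_ge; exists 1%N => // n /= n0.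
rewrite lee_fin ler_pdivlMr ?ltr0n//.
have -> : ln 4%:R * n%:R = ln (4 ^ n)%:R :> R by rewrite natrX lnXn// mulr_natr.
rewrite ler_ln ?posrE ?ltr0n ?expn_gt0// ?ler_nat ?cover_number_ge//.
by rewrite (leq_trans _ (cover_number_ge n))// expn_gt0.
Qed.

End TopologicalEntropy.

(** * Comparison of the two measures *)

Section CodingMap.
Variables (R : realType) (A : circle R -> circle R).
Hypothesis hA : is_higher_bowen_series A.
Variable psi : boundary -> circle R.
Hypothesis hpsi : is_coding_map A psi.

Lemma subshift_code xi : subshift A (code xi).
Proof. by move=> k; apply: bs_arc_succ => //; exact: code_succ. Qed.

Lemma psi_shift xi : psi (boundary_shift xi) = A (psi xi).
Proof.
have [_ _ h _] := hpsi; apply: (h (code xi)); first exact: subshift_code.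
  exact/codesP.
by apply/codesP => k; rewrite code_shift.
Qed.

Lemma psi_arc xi n : bs_arc (code xi n) (iter n A (psi xi)).
Proof.
elim: n xi => [|n IH] xi; last first.
  have := IH (boundary_shift xi); rewrite code_shift psi_shift -iterSr.
  exact.
have [_ _ _ <-] := hpsi; exists xi => //; exists (code xi).
by split=> //; [exact: subshift_code|exact/codesP].
Qed.

Lemma sym_psi xi n : sym (iter n A (psi xi)) \in
  [:: inl (code xi n); inr (code xi n); inr (ordS (code xi n))].
Proof. exact/bs_arcE/psi_arc. Qed.

Lemma sym_psi_code xi n i : sym (iter n A (psi xi)) = inl i -> code xi n = i.
Proof. by move=> h; have := sym_psi xi n; rewrite h !inE orbF => /eqP[]. Qed.

Lemma itin_inj n x y : itin A (@sym R) n x = itin A (@sym R) n y ->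
  iter n A x = iter n A y -> x = y.
Proof.
elim: n x y => [|n IH] x y //; rewrite !itinS !iterSr => -[sxy ixy] Axy.
by apply: (bs_inj hA) => //; exact: IH.
Qed.

(** Both orbits are at the same vertex at the same time, and [A] is injective on each symbol, so one
    can go back. *)
Lemma itin_vertex_inj n x y : itin A (@sym R) n x = itin A (@sym R) n y ->
  (exists k, inr k \in itin A (@sym R) n x) -> x = y.
Proof.
move=> xy [v /(nthP (inr v))[k]]; rewrite size_itin => kn.
have nthE z : nth (inr v) (itin A (@sym R) n z) k = sym (iter k A z).
  by rewrite nth_mkseq.
move=> xv; have yv := xv; rewrite xy in yv; rewrite !nthE in xv yv.
apply: (@itin_inj k).
  by rewrite -(take_itin _ _ _ (ltnW kn)) xy take_itin// ltnW.
by move/sym_inr: xv => ->; move/sym_inr: yv => ->.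
Qed.

(** An itinerary that meets a vertex determines its point. Otherwise all symbols are open arcs, and
    these force the letters of any code above [x] or [y]; continuity of [psi] at a code of [x]
    concludes. *)
Lemma itin_generating (U : set (circle R)) x : open U -> U x ->
  exists n, forall y, itin A (@sym R) n y = itin A (@sym R) n x -> U y.
Proof.
move=> oU Ux; have [cpsi rpsi _ _] := hpsi.
have [[n hn]|nv] := pselect (exists n, exists k, inr k \in itin A (@sym R) n x).
  by exists n => y yx; rewrite -(itin_vertex_inj (esym yx) hn).
have : range psi x by rewrite rpsi.
move=> [xi _ xix].
have arc k : sym (iter k A x) = inl (code xi k).
  case xk : (sym (iter k A x)) => [i|i].
    by move: xk; rewrite -xix => /sym_psi_code ->.
  exfalso; apply: nv; exists k.+1, i; apply/(nthP (inr i)); exists k.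
    by rewrite size_itin.
  by rewrite nth_mkseq.
have : open (psi @^-1` U) by move/continuousP: cpsi; apply.
move=> [V oV VU]; have : V (inr xi) by rewrite -[V (inr xi)]/((inr @^-1` V) xi) VU /= xix.
move=> /(oV xi)[N NV]; exists N => y yx.
have [eta _ etay] : range psi y by rewrite rpsi.
rewrite -etay -[U (psi eta)]/((psi @^-1` U) eta) -VU; apply: NV.
apply/shadow_boundary; apply: (@eq_from_nth _ ord0); rewrite !size_mkseq// => k kN.
rewrite !nth_mkseq//; apply/esym/sym_psi_code; rewrite etay -arc.
by have := congr1 (nth (inr ord0) ^~ k) yx; rewrite !nth_mkseq.
Qed.

End CodingMap.

(** * Masses of words under both measures *)

Section Comparison.
Variables (R : realType) (A : circle R -> circle R).
Hypothesis hA : is_higher_bowen_series A.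
Variable nu : probability (borel (circle R)) R.
Hypothesis hnu : is_maximal_entropy A nu.
Variable mu : probability (borel boundary) R.
Hypothesis hmu : is_patterson_sullivan mu.
Variable psi : boundary -> circle R.
Hypothesis hpsi : is_coding_map A psi.

Let word w : set (borel (circle R)) := word_set A (@sym R) w.
Let p w : R := prob nu (word w).

Lemma A_measurable : measurable_fun setT (A : borel (circle R) -> borel (circle R)).
Proof. exact: continuous_borel hA.1. Qed.

Lemma psi_measurable :
  measurable_fun setT (psi : borel boundary -> borel (circle R)).
Proof. by apply: continuous_borel; have [] := hpsi. Qed.

Lemma nu_entropy :
  ((ln 4%:R)%:E <= measure_entropy nu (A : borel (circle R) -> borel (circle R)))%E.
Proof. by rewrite hnu.2; exact: topological_entropy_ge hA. Qed.

Lemma nu_word_cons a t w : adm a t -> p (t :: w) = 4 * p [:: a, t & w].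
Proof.
move=> at_; apply: (@prob_word_cons _ _ nu A _ (@sym R) adm 4) => //.
- exact: A_measurable.
- exact: hnu.1.
- exact: sym_measurable.
- exact: itin_generating hA _ hpsi.
- exact: adm_sym hA.
- by move=> s; rewrite adm_pred_sum.
- exact: adm_pred_sum.
- exact: nu_entropy.
Qed.

Lemma nu_word_nonadm a t w : ~~ adm a t -> p [:: a, t & w] = 0.
Proof.
by move=> at_; rewrite /p /word (word_set_nontr (adm_sym hA) w at_) prob0.
Qed.

Lemma word_measurable w : measurable (word w).
Proof. by apply: word_set_measurable; [exact: A_measurable|exact: sym_measurable]. Qed.

(** The image of a vertex has four times its mass. Every vertex reaches a fixed vertex in one step,
    and a fixed vertex must then be null. *)
Lemma nu_word_vertex k : p [:: inr k] = 0.
Proof.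
have pk l : p [:: inr (vimage l)] = 4 * p [:: inr l].
  rewrite (@nu_word_cons (inr l)) /= ?eqxx//; congr (_ * prob _ _).
  apply/seteqP; split=> x; rewrite /word /word_set /= !itinS; first by move=> [->].
  by move=> [/sym_inr ->]; rewrite (bs_image_vertex hA) !sym_vertex.
have p0 l : vimage l = l -> p [:: inr l] = 0 by move=> e; have := pk l; rewrite e; lra.
by have := pk k; rewrite (p0 (vimage k)); [lra|elim/ord6_ind: k].
Qed.

Lemma nu_word_has_vertex w k : inr k \in w -> p w = 0.
Proof.
elim: w => // -[i|i] w IH; last first.
  move=> _; apply/eqP; rewrite eq_le prob_ge0 andbT -(nu_word_vertex i).
  apply: prob_le; [exact: word_measurable|exact: word_measurable|].
  by move=> x; rewrite /word /word_set /= !itinS => -[->].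
rewrite inE /= => kw; have := IH kw; case: w kw {IH} => // t w _ pw.
have [it|it] := boolP (adm (inl i) t); last exact: nu_word_nonadm.
by have := nu_word_cons w it; rewrite pw; lra.
Qed.

(** Splitting an arc by its next symbol shows that four times its mass is the total mass of its
    successor arcs. With total mass 1, the only solution of this linear system is constant. *)
Lemma nu_word_arc i : p [:: inl i] = 6^-1.
Proof.
have mA : finitely_measurable ((@sym R) \o A : borel (circle R) -> symbol).
  move=> s; rewrite comp_preimage -[X in measurable X]setTI.
  by apply: A_measurable => //; exact: sym_measurable.
have step l : 4 * p [:: inl l] = \sum_j (p [:: inl j] *+ succ l j).
  have <- : \sum_s p [:: inl l; s] = p [:: inl l].
    rewrite {2}/p -(prob_partition nu mA (word_measurable [:: inl l])).
    apply: eq_bigr => s _; congr prob; apply/seteqP; split=> x; rewrite /word /word_set /= !itinS.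
      by move=> [xl xs]; rewrite xl; split.
    by move=> [[xl] /= xs]; rewrite xl xs.
  rewrite mulr_sumr big_sumType /= [X in _ + X]big1 ?addr0 => [|k _]; last first.
    by rewrite (@nu_word_has_vertex _ k) ?mulr0// !inE eqxx orbT.
  apply: eq_bigr => j _; case: (boolP (succ l j)) => lj.
    by rewrite mulr1n -(@nu_word_cons (inl l) (inl j) [::] lj).
  by rewrite nu_word_nonadm ?mulr0.
have tot : \sum_j p [:: inl j] = 1.
  rewrite -(sum_prob nu (@sym_measurable R)) [RHS]big_sumType /= [X in _ + X]big1 => [|k _].
    rewrite addr0; apply: eq_bigr => j _; congr prob.
    by apply/seteqP; split=> x; rewrite /word /word_set /= itinS; [move=> []|move=> ->].
  rewrite -(nu_word_vertex k); congr prob.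
  by apply/seteqP; split=> x; rewrite /word /word_set /= itinS; [move=> ->|move=> []].
have := step (O6 0); have := step (O6 1); have := step (O6 2).
have := step (O6 3); have := step (O6 4); have := step (O6 5).
move: tot; rewrite !big_ord_recl !big_ord0 /=.
have -> : lift ord0 ord0 = O6 1 by apply: val_inj.
have -> : lift ord0 (lift ord0 ord0) = O6 2 by apply: val_inj.
have -> : lift ord0 (lift ord0 (lift ord0 ord0)) = O6 3 by apply: val_inj.
have -> : lift ord0 (lift ord0 (lift ord0 (lift ord0 ord0))) = O6 4 by apply: val_inj.
have -> : lift ord0 (lift ord0 (lift ord0 (lift ord0 (lift ord0 ord0)))) = O6 5.
  by apply: val_inj.
have -> : ord0 = O6 0 by apply: val_inj.
rewrite /succ /= !mulr1n !mulr0n.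
by elim/ord6_ind: i; lra.
Qed.

Lemma nu_word_arcs w : sorted succ w -> w != [::] ->
  p (map inl w) = 6^-1 * 4^-1 ^+ (size w).-1.
Proof.
elim: w => // i [|j w] IH; first by rewrite nu_word_arc expr0 mulr1.
move=> /= /andP[ij jw] _; have := @nu_word_cons (inl i) (inl j) (map inl w) ij.
by rewrite [p (inl j :: _)]IH//= exprS => e; lra.
Qed.

Let q w : R := prob mu (psi @^-1` word w).

Lemma psi_preimage_measurable (B : set (borel (circle R))) :
  measurable B -> measurable (psi @^-1` B : set (borel boundary)).
Proof. by move=> mB; rewrite -[X in measurable X]setTI; exact: psi_measurable. Qed.

(** An open arc visited by the orbit determines the letter of the code, whereas a vertex leaves two
    choices. *)
Lemma cyl_of_arcs w : psi @^-1` word (map inl w) `<=` cyl w.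
Proof.
move=> xi /= xw; apply/cylE => k kw; apply: (sym_psi_code hA hpsi).
have := congr1 (nth (inr ord0) ^~ k) xw.
by rewrite size_map nth_mkseq// (nth_map ord0).
Qed.

Lemma prob_cyl_le w : w != [::] -> prob mu (cyl w) <= 6^-1 * 4^-1 ^+ (size w).-1.
Proof.
move=> w0; have [sw|sw] := boolP (sorted succ w); first by rewrite prob_cyl.
by rewrite cyl_nonadm// prob0 mulr_ge0// ?exprn_ge0 ?invr_ge0.
Qed.

Lemma prob_cover_le (L : seq (seq 'I_6)) (S : set (borel boundary)) (c : R) :
    measurable S -> (forall w, w \in L -> prob mu (cyl w) <= c) ->
    (forall xi, S xi -> exists2 w, w \in L & cyl w xi) ->
  prob mu S <= (size L)%:R * c.
Proof.
elim: L S => [|w L IH] S mS Lc SL.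
  by rewrite mul0r (_ : S = set0) ?prob0//; apply/seteqP; split=> // xi /SL[].
have mc := cyl_measurable w.
apply: (@le_trans _ _ (prob mu (cyl w `|` (S `\` cyl w)))).
  apply: prob_le => //; first by apply: measurableU => //; exact: measurableD.
  by move=> xi Sxi; have [?|?] := pselect (cyl w xi); [left|right].
apply: le_trans (prob_setU_le _ mc (measurableD mS mc)) _.
rewrite /= mulrSr mulrDl mul1r addrC lerD//; last by apply: Lc; rewrite mem_head.
apply: IH; first exact: measurableD.
  by move=> v vL; apply: Lc; rewrite inE vL orbT.
move=> xi [/SL[v]]; rewrite inE => /predU1P[->//|vL vxi _]; by exists v.
Qed.

(** Candidates for the first [n] letters of the codes above [z]: the closed arcs met by the orbit,
    at most two at each time. *)
Fixpoint codings (n : nat) (z : circle R) : seq (seq 'I_6) :=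
  if n is m.+1 then
    [seq i :: v | i <- [seq i <- enum 'I_6 | sym z \in [:: inl i; inr i; inr (ordS i)]],
                  v <- codings m (A z)]
  else [:: [::]].

Lemma size_codings n z : (size (codings n z) <= 2 ^ n)%N.
Proof.
elim: n z => //= n IH z; rewrite size_allpairs expnS leq_mul//.
rewrite size_filter -sum1_count big_mkcond big_enum /= !big_ord_recl big_ord0.
by case: (sym z); elim/ord6_ind.
Qed.

Lemma mem_codings n xi z : psi xi = z -> mkseq (code xi) n \in codings n z.
Proof.
elim: n xi z => [|n IH] xi z xiz; first by rewrite inE.
have -> : mkseq (code xi) n.+1 = code xi 0 :: mkseq (code (boundary_shift xi)) n.
  rewrite /mkseq /= (iotaDl 1 0 n) -map_comp; congr (_ :: _).
  by apply: eq_map => k; rewrite /= code_shift.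
rewrite /= allpairs_f ?IH// ?psi_shift ?xiz//.
  by rewrite mem_filter mem_enum andbT -xiz; exact: (sym_psi hA hpsi xi 0).
by rewrite (psi_shift hA hpsi) xiz.
Qed.

Lemma point_null (z : circle R) (S : set (borel boundary)) :
  measurable S -> S `<=` psi @^-1` [set z] -> prob mu S = 0.
Proof.
move=> mS Sz; apply/eqP; rewrite eq_le prob_ge0 andbT leNgt; apply/negP => S0.
(* At most [2 ^ (n + 1)] cylinders of mass at most [4 ^ (- n) / 6] give
   [prob mu S <= 2 ^ (- n) / 3], and [n + 1 <= 2 ^ n]. *)
have bound n : prob mu S * n.+1%:R <= 1.
  have : prob mu S <= (size (codings n.+1 z))%:R * (6^-1 * 4^-1 ^+ n).
    apply: prob_cover_le => // [w|xi /Sz xiz]; last first.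
      exists (mkseq (code xi) n.+1); first exact: mem_codings.
      by apply/cylE => k; rewrite size_mkseq => kn; rewrite nth_mkseq.
    move=> wL; have sw : size w = n.+1.
      elim: (n.+1) (z) w wL => [|m IH] y w /=; first by rewrite inE => /eqP ->.
      by move=> /allpairsP[[i v] [/= _ /IH <- ->]].
    by rewrite -[n]/(n.+1.-1) -sw; apply: prob_cyl_le; rewrite -size_eq0 sw.
  move=> Sn; pose a : R := 2 ^+ n; have a0 : 0 < a by rewrite exprn_gt0.
  have e4 : 4^-1 ^+ n = a^-1 * a^-1 :> R.
    by rewrite -exprVn -exprMn; congr (_ ^+ n); field.
  have na : n.+1%:R <= a by rewrite /a -natrX ler_nat ltn_expl.
  have sa : (size (codings n.+1 z))%:R <= 2 * a.
    by rewrite /a -exprS -natrX ler_nat size_codings.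
  have Sa : prob mu S <= 3^-1 * a^-1.
    apply: le_trans Sn _; rewrite e4.
    apply: (@le_trans _ _ (2 * a * (6^-1 * (a^-1 * a^-1)))).
      by rewrite ler_wpM2r// !mulr_ge0 ?invr_ge0// ltW.
    by rewrite le_eqVlt; apply/orP; left; apply/eqP; field; rewrite gt_eqF.
  apply: (@le_trans _ _ (3^-1 * a^-1 * a)); first by rewrite ler_pM// ltW.
  by rewrite mulfVK ?gt_eqF//; lra.
have := bound (Num.truncn (prob mu S)^-1); apply/negP; rewrite -ltNge.
by rewrite mulrC -ltr_pdivrMr// mul1r truncnS_gt.
Qed.

(** A word with a vertex describes at most one point, so its preimage is null. A word of arcs pulls
    back into a cylinder whose mass is that of the word, or which is empty. *)
Lemma word_preimage_le w : q w <= p w.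
Proof.
have mq : measurable (psi @^-1` word w : set (borel boundary)).
  by apply: psi_preimage_measurable; exact: word_measurable.
have [[k kw]|nv] := pselect (exists k, inr k \in w).
  rewrite (nu_word_has_vertex kw).
  have [[z wz]|nz] := pselect (exists z, word w z); last first.
    rewrite /q [X in prob _ X](_ : _ = set0) ?prob0//.
    by apply/seteqP; split=> // xi xw; apply: nz; exists (psi xi).
  rewrite /q (point_null (z := z) mq)// => xi xw.
  by apply: (itin_vertex_inj hA (n := size w)); rewrite ?xw ?wz//; exists k.
have [w' wE] : exists w', w = map inl w'.
  elim: (w) nv => [|[i|i] v IH] nv; first by exists [::].
    have [|v' ->] := IH; last by exists (i :: v').
    by move=> [k kv]; apply: nv; exists k; rewrite inE kv orbT.
  by case: nv; exists i; rewrite mem_head.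
have [w0|w0] := eqVneq w' [::].
  have wT : word w = setT by rewrite wE w0; apply/seteqP.
  by rewrite /q /p wT preimage_setT !probT.
have [sw|sw] := boolP (sorted succ w').
  rewrite wE nu_word_arcs// -(prob_cyl hmu sw w0); apply: prob_le.
  - by rewrite -wE.
  - exact: cyl_measurable.
  - exact: cyl_of_arcs.
rewrite (_ : q w = 0) ?prob_ge0// /q wE [X in prob _ X](_ : _ = set0) ?prob0//.
by apply/seteqP; split=> // xi /cyl_of_arcs; rewrite cyl_nonadm.
Qed.

(** Summing over words gives the inequality for an itinerary set and for its complement; both
    measures have total mass 1, so it is an equality. *)
Lemma itin_set_preimage n (W : seq symbol -> bool) :
  prob mu (psi @^-1` itin_set A (@sym R) n W) = prob nu (itin_set A (@sym R) n W).
Proof.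
have mt := finitely_measurable_titin A_measurable (@sym_measurable R) (n := n).
have le V : prob mu (psi @^-1` itin_set A (@sym R) n V) <= prob nu (itin_set A (@sym R) n V).
  have mtp : finitely_measurable (titin A (@sym R) n \o psi : borel boundary -> _).
    by move=> t; rewrite comp_preimage; exact: psi_preimage_measurable.
  pose g (t : n.-tuple symbol) := V t.
  have -> : itin_set A (@sym R) n V = (g \o titin A (@sym R) n) @^-1` [set true] by [].
  have -> : psi @^-1` ((g \o titin A (@sym R) n) @^-1` [set true]) =
     (g \o (titin A (@sym R) n \o psi)) @^-1` [set true] by [].
  rewrite !prob_comp//; apply: ler_sum => t _.
  have tE : titin A (@sym R) n @^-1` [set t] = word t.
    apply/seteqP; split=> x; rewrite /word /word_set /mkset size_tuple.
      by move=> <-.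
    by move=> xt; apply: val_inj.
  by rewrite comp_preimage tE; exact: word_preimage_le.
apply/eqP; rewrite eq_le le /=.
have mW := itin_set_measurable A_measurable (@sym_measurable R) n W.
have := le (fun s => ~~ W s).
have -> : itin_set A (@sym R) n (fun s => ~~ W s) = ~` itin_set A (@sym R) n W.
  by apply/seteqP; split=> x; rewrite /itin_set /= => /negP.
have mpW := psi_preimage_measurable mW.
by rewrite preimage_setC (prob_setC nu mW) (prob_setC mu mpW) lerD2l lerN2.
Qed.

Lemma open_preimage (U : set (circle R)) : open U -> mu (psi @^-1` U) = nu U.
Proof.
move=> oU.
pose E n := itin_set A (@sym R) n
  (fun s => `[< forall y, itin A (@sym R) n y = s -> U y >]).
have mE n : measurable (E n).
  by apply: itin_set_measurable; [exact: A_measurable|exact: sym_measurable].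
have ndE : nondecreasing_seq E.
  apply/nondecreasing_seqP => n; apply/subsetPset => x /asboolP xU.
  apply/asboolP => y yx; apply: xU.
  by rewrite -(take_itin A (@sym R) y (leqnSn n)) yx take_itin.
have UE : U = \bigcup_n E n.
  apply/seteqP; split=> [x Ux|x [n _ /asboolP]]; last exact.
  have [n nU] := itin_generating hA hpsi oU Ux.
  by exists n => //; exact/asboolP.
have mpE n : measurable (psi @^-1` E n : set (borel boundary)).
  exact: psi_preimage_measurable.
have h1 : (fun n => nu (E n)) @ \oo --> nu U.
  rewrite UE; apply: nondecreasing_cvg_mu => //.
  exact: bigcup_measurable.
have h2 : (fun n => mu (psi @^-1` E n)) @ \oo --> mu (psi @^-1` U).
  rewrite UE preimage_bigcup; 
  apply: (@nondecreasing_cvg_mu _ (borel boundary) R mu (fun n => psi @^-1` E n)) => //.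
    exact: bigcup_measurable.
  by move=> m n mn; apply/subsetPset; apply: preimage_subset; exact/subsetPset/ndE.
have EE : (fun n => mu (psi @^-1` E n)) = (fun n => nu (E n)).
  by apply/funext => n; rewrite !probE//; congr EFin; exact: itin_set_preimage.
by move: h2; rewrite EE => /cvg_lim <- //; apply/cvg_lim.
Qed.

End Comparison.

Theorem proposition6p17 (R : realType)
  (A : circle R -> circle R) (hA : is_higher_bowen_series A)
  (nu : probability (borel (circle R)) R) (hnu : is_maximal_entropy A nu)
  (mu : probability (borel boundary) R) (hmu : is_patterson_sullivan mu)
  (psi : boundary -> circle R) (hpsi : is_coding_map A psi) :
  forall B : set (borel (circle R)), measurable B ->
    nu B = pushforward mu (psi : borel boundary -> borel (circle R)) B.
Proof.
have mpsi := psi_measurable hpsi.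
pose M := (pushforward mu (psi : borel boundary -> borel (circle R)) :
  {measure set _ -> \bar R}).
have oI : setI_closed (@open (circle R)) by move=> U V; exact: openI.
have cT : \bigcup_(k in [set: nat]) (fun=> [set: circle R]) k = setT.
  by rewrite bigcup_const//; exists 0%N.
(* The open sets are stable under intersection and generate the Borel sets, so agreement on them
   suffices. *)
move=> B mB; apply: (@measure_unique _ R (borel (circle R)) (@open (circle R))
  (fun=> setT) erefl oI (fun=> openT) cT nu (M mpsi)) => //.
- by move=> U oU; exact: esym (open_preimage hA hnu hmu hpsi oU).
- by move=> _; rewrite [X in (X < _)%E]probability_setT ltry.
Qed.
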